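(* Let $q$ be a fixed constant. The Dota Underlords problem with alliances of size (at most) $q$ reduces to the maximum edge-weighted clique problem: there is an edge-weighted graph, of size bounded by a polynomial in the size of the Dota Underlords instance, such that an optimal solution of the Dota Underlords instance is obtained from a maximum edge-weighted clique of that graph.
   Context: The Dota Underlords (DU) problem. An instance consists of: $n\in\mathbb{N}$ heroes; a maximum team size $m\in\mathbb{N}$; $t\in\mathbb{N}$ alliances; a maximum alliance size $q\in\mathbb{N}$; hero strengths $s_i\in\mathbb{R}$; an incidence matrix $a_{ij}\in\{0,1\}$ with $a_{ij}=1$ iff hero $i$ belongs to alliance $j$, satisfying $\sum_{i=1}^n a_{ij}\le q$ for every $j$; and bonuses $e_{ijk}\in\mathbb{R}$ ($1\le i\le n$, $1\le j\le t$, $1\le k\le q$), where $e_{ijk}$ is the bonus to hero $i$ when at least $k$ heroes of alliance $j$ are in the team. The problem is the integer program: maximize $\sum_{i=1}^n x_i s_i+\sum_{i,j,k} e_{ijk}I_{ijk}$ over $x_i\in\{0,1\}$ ($x_i=1$ iff hero $i$ is in the team) and $I_{ijk}\in\{0,1\}$, subject to $\sum_{i=1}^n x_i\le m$; $I_{ijk}\le x_i$ for all $i,j,k$; and $\sum_{i'=1}^n a_{i'j}x_{i'}-k\ge M(I_{ijk}-1)$ for all $i,j,k$, where $M$ is a constant larger than $q$ (so $I_{ijk}=1$ is possible only if the team contains at least $k$ heroes of alliance $j$). The maximum edge-weighted clique (MEWC) problem: given an undirected graph with real edge weights, find a clique maximizing the total weight of its edges. *)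

(* Defs.v *)
From HB Require Import structures.
From mathcomp Require Import all_boot all_order all_algebra.
From mathcomp Require Import reals.

Set Implicit Arguments.
Unset Strict Implicit.
Unset Printing Implicit Defensive.

Import Order.TTheory GRing.Theory Num.Theory.
Local Open Scope ring_scope.

(** * The Dota Underlords problem *)

(* Heroes and alliances are numbered from 0.  A threshold k in {1, ..., q} is
   represented by the ordinal k - 1, so [k : 'I_q] stands for the threshold
   [k.+1]. *)
Record du (R : realType) (q : nat) := DU {
  heroes : nat;
  team_max : nat;
  alliances : nat;
  strength : 'I_heroes -> R;
  member : 'I_heroes -> 'I_alliances -> bool;
  bonus : 'I_heroes -> 'I_alliances -> 'I_q -> R;
  alliance_size : forall j, (\sum_i member i j <= q)%N
}.

Arguments strength {R q} D i : rename.
Arguments member {R q} D i j : rename.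
Arguments bonus {R q} D i j k : rename.

(* The numbers listed in an instance, plus the heroes and alliances themselves
   (these matter when one of the two kinds is absent).  [team_max] is one
   number and does not contribute its magnitude. *)
Definition du_size (R : realType) (q : nat) (D : du R q) : nat :=
  (heroes D + alliances D + heroes D * alliances D
   + heroes D * alliances D * q)%N.

Definition du_team (R : realType) (q : nat) (D : du R q) :=
  'I_(heroes D) -> bool.
Definition du_active (R : realType) (q : nat) (D : du R q) :=
  'I_(heroes D) -> 'I_(alliances D) -> 'I_q -> bool.

Definition du_objective (R : realType) (q : nat) (D : du R q)
    (x : du_team D) (y : du_active D) : R :=
  \sum_i (x i)%:R * strength D i
  + \sum_i \sum_j \sum_k bonus D i j k * (y i j k)%:R.

Arguments du_objective {R q} D x y.

Definition du_feasible (R : realType) (q : nat) (M : R) (D : du R q)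
    (x : du_team D) (y : du_active D) : Prop :=
  [/\ (\sum_i x i <= team_max D)%N,
      forall i j k, (y i j k <= x i)%N
    & forall i j k,
        M * ((y i j k)%:R - 1)
        <= \sum_i' (member D i' j)%:R * (x i')%:R - (k.+1)%:R].

Arguments du_feasible {R q} M D x y.

Definition du_optimal (R : realType) (q : nat) (M : R) (D : du R q)
    (x : du_team D) (y : du_active D) : Prop :=
  du_feasible M D x y
  /\ forall x' y', du_feasible M D x' y' ->
       du_objective D x' y' <= du_objective D x y.

Arguments du_optimal {R q} M D x y.

(** * The maximum edge-weighted clique problem *)

(* [weight u v] is meaningful only when [edge u v]. *)
Record wgraph (R : realType) := WGraph {
  nvertices : nat;
  edge : rel 'I_nvertices;
  weight : 'I_nvertices -> 'I_nvertices -> R;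
  edge_sym : symmetric edge;
  edge_irr : irreflexive edge;
  weight_sym : forall u v, weight u v = weight v u
}.

Definition clique (R : realType) (G : wgraph R)
    (C : {set 'I_(nvertices G)}) : Prop :=
  forall u v, u \in C -> v \in C -> u != v -> edge u v.

Arguments clique {R} G C.

Definition clique_weight (R : realType) (G : wgraph R)
    (C : {set 'I_(nvertices G)}) : R :=
  \sum_(u in C) \sum_(v in C | (u < v)%N) weight u v.

Arguments clique_weight {R} G C.

Definition max_clique (R : realType) (G : wgraph R)
    (C : {set 'I_(nvertices G)}) : Prop :=
  clique G C
  /\ forall C', clique G C' -> clique_weight G C' <= clique_weight G C.

Arguments max_clique {R} G C.

(** * Programs with a running time

   A random-access machine with a store of naturals and a store of reals.  A
   cell is addressed by an array name and a list of indices (the empty list for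
   a scalar variable).  Numbers are only added, subtracted and compared: without
   multiplication, T steps increase the bit length of numbers by O(T) only, so
   polynomial unit-cost time is polynomial bit-cost time when the reals in the
   input are rational.  Loops are bounded; nested loops provide any polynomial
   clock, so these programs capture polynomial time. *)

Record memory (R : realType) := Memory {
  natcell : nat -> seq nat -> nat;
  realcell : nat -> seq nat -> R
}.

Inductive nexp :=
  | NConst of nat
  | NGet of nat & seq nexp
  | NAdd of nexp & nexp
  | NSub of nexp & nexp.

Inductive rexp :=
  | RZero
  | ROne
  | RGet of nat & seq nexp
  | RAdd of rexp & rexp
  | RSub of rexp & rexp.

Inductive bexp :=
  | NLe of nexp & nexp
  | RLe of rexp & rexp
  | BNot of bexp
  | BAnd of bexp & bexp.

Inductive cmd :=
  | Skip
  | NSet of nat & seq nexp & nexp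
  | RSet of nat & seq nexp & rexp
  | Seq of cmd & cmd
  | If of bexp & cmd & cmd
  | For of nat & nexp & cmd.

Fixpoint neval (R : realType) (m : memory R) (e : nexp) : nat :=
  match e with
  | NConst c => c
  | NGet v ix => natcell m v (map (neval m) ix)
  | NAdd e1 e2 => (neval m e1 + neval m e2)%N
  | NSub e1 e2 => (neval m e1 - neval m e2)%N
  end.

Fixpoint reval (R : realType) (m : memory R) (e : rexp) : R :=
  match e with
  | RZero => 0
  | ROne => 1
  | RGet v ix => realcell m v (map (neval m) ix)
  | RAdd e1 e2 => reval m e1 + reval m e2
  | RSub e1 e2 => reval m e1 - reval m e2
  end.

Fixpoint beval (R : realType) (m : memory R) (b : bexp) : bool :=
  match b with
  | NLe e1 e2 => (neval m e1 <= neval m e2)%N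
  | RLe e1 e2 => reval m e1 <= reval m e2
  | BNot b1 => ~~ beval m b1
  | BAnd b1 b2 => beval m b1 && beval m b2
  end.

Definition upd (V : Type) (f : nat -> seq nat -> V) (v : nat) (ix : seq nat)
    (c : V) : nat -> seq nat -> V :=
  fun v' ix' => if (v' == v) && (ix' == ix) then c else f v' ix'.

Definition nset (R : realType) (v : nat) (ix : seq nat) (c : nat) (m : memory R) :
    memory R :=
  Memory (upd (natcell m) v ix c) (realcell m).

Definition rset (R : realType) (v : nat) (ix : seq nat) (c : R) (m : memory R) :
    memory R :=
  Memory (natcell m) (upd (realcell m) v ix c).

(* The number of steps and the final memory.  Expressions contain no loops, so
   the cost of evaluating one is bounded by a constant of the program; each
   assignment and test is counted as one step.  [For v e c] evaluates [e] once
   and runs [c] with [v] set to 0, 1, ..., e - 1 in turn. *)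
Fixpoint run (R : realType) (c : cmd) (m : memory R) : nat * memory R :=
  match c with
  | Skip => (1%N, m)
  | NSet v ix e => (1%N, nset v (map (neval m) ix) (neval m e) m)
  | RSet v ix e => (1%N, rset v (map (neval m) ix) (reval m e) m)
  | Seq c1 c2 =>
      let r1 := run c1 m in
      let r2 := run c2 r1.2 in
      ((r1.1 + r2.1)%N, r2.2)
  | If b c1 c2 =>
      let r := run (if beval m b then c1 else c2) m in (r.1.+1, r.2)
  | For v e c1 =>
      foldl (fun (acc : nat * memory R) (i : nat) =>
               let r := run c1 (nset v [::] i acc.2) in
               ((acc.1 + r.1).+1, r.2))
            (1%N, m) (iota 0 (neval m e))
  end.

Definition time (R : realType) (c : cmd) (m : memory R) : nat := (run c m).1.
Definition final (R : realType) (c : cmd) (m : memory R) : memory R := (run c m).2.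

(** * Input and output conventions *)

Definition n_heroes := 0%N.
Definition n_team_max := 1%N.
Definition n_alliances := 2%N.
Definition n_member := 3%N.
Definition n_order := 4%N.
Definition n_edge := 5%N.
Definition n_clique := 6%N.
Definition n_team := 7%N.
Definition n_active := 8%N.

Definition r_strength := 0%N.
Definition r_bonus := 1%N.
Definition r_weight := 2%N.

Definition extend (V : Type) (z : V) (n : nat) (f : 'I_n -> V) (i : nat) : V :=
  oapp f z (insub i).

(* Cells that carry no input are zero. *)
Definition du_mem (R : realType) (q : nat) (D : du R q) : memory R :=
  Memory
    (fun v ix =>
       if (v == n_heroes) && (ix == [::]) then heroes D
       else if (v == n_team_max) && (ix == [::]) then team_max D
       else if (v == n_alliances) && (ix == [::]) then alliances D
       else if v == n_member then
         if ix is [:: i; j] then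
           extend 0%N
             (fun i' => extend 0%N (fun j' => nat_of_bool (member D i' j')) j) i
         else 0%N
       else 0%N)
    (fun v ix =>
       if v == r_strength then
         if ix is [:: i] then extend 0 (strength D) i else 0
       else if v == r_bonus then
         if ix is [:: i; j; k] then
           extend 0 (fun i' => extend 0 (fun j' => extend 0 (bonus D i' j') k) j) i
         else 0
       else 0).

(* The instance together with the indicator vector of a set of vertices. *)
Definition du_clique_mem (R : realType) (q : nat) (D : du R q) (n : nat)
    (C : {set 'I_n}) : memory R :=
  Memory
    (fun v ix =>
       if v == n_clique then
         if ix is [:: u] then extend 0%N (fun u' => nat_of_bool (u' \in C)) u
         else 0%N
       else natcell (du_mem D) v ix)
    (realcell (du_mem D)).

Definition holds_graph (R : realType) (m : memory R) (G : wgraph R) : Prop :=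
  [/\ natcell m n_order [::] = nvertices G,
      forall u v : 'I_(nvertices G),
        natcell m n_edge [:: val u; val v] = edge u v
    & forall u v : 'I_(nvertices G), edge u v ->
        realcell m r_weight [:: val u; val v] = weight u v].

Definition holds_solution (R : realType) (q : nat) (m : memory R) (D : du R q)
    (x : du_team D) (y : du_active D) : Prop :=
  (forall i, natcell m n_team [:: val i] = x i)
  /\ (forall i j k, natcell m n_active [:: val i; val j; val k] = y i j k).

(* Main.v *)
(* A team and the thresholds it reaches are the values of finitely many variables
   with pairwise constraints and pairwise gains: hero i has a place v in
   {0, ..., m}, with 0 for "not in the team" and nonzero places distinct, and
   threshold k of alliance j has a witness, either none or a member of j in the
   team, with distinct witnesses for distinct thresholds and a witness for every
   smaller threshold.  Vertices are pairs (variable, value) and edges join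
   compatible values of distinct variables, so a clique is a partial consistent
   assignment.  A prize on each edge, exceeding twice the total of all gains, makes
   every maximum clique a full assignment, whose gain is then the objective of the
   team it describes: a bonus is counted when the hero is in the team, the
   threshold has a witness and the bonus is nonnegative. *)

Require Import Defs.
From mathcomp Require Import all_boot all_order all_algebra.
From mathcomp Require Import reals.
From mathcomp Require Import zify lra.

Set Implicit Arguments.
Unset Strict Implicit.
Unset Printing Implicit Defensive.

Import Order.TTheory GRing.Theory Num.Theory.
Local Open Scope ring_scope.

(** * Reasoning about programs *)

Section Machine.
Variable R : realType.
Implicit Types (m : memory R) (c : cmd).

(** * Frame conditions *)

Fixpoint nwrites c : seq nat :=
  match c with
  | Skip => [::]
  | NSet v _ _ => [:: v]
  | RSet _ _ _ => [::]
  | Seq c1 c2 => nwrites c1 ++ nwrites c2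
  | If _ c1 c2 => nwrites c1 ++ nwrites c2
  | For v _ c1 => v :: nwrites c1
  end.

Fixpoint rwrites c : seq nat :=
  match c with
  | Skip => [::]
  | NSet _ _ _ => [::]
  | RSet v _ _ => [:: v]
  | Seq c1 c2 => rwrites c1 ++ rwrites c2
  | If _ c1 c2 => rwrites c1 ++ rwrites c2
  | For _ _ c1 => rwrites c1
  end.

(** A frame condition relating two arbitrary memories rather than one run: being transitive, it can
    be carried through loops. The write sets are syntactic, so for concrete programs its side
    conditions hold by computation. *)
Definition agree c m m' : Prop :=
  (forall v, v \notin nwrites c -> natcell m' v = natcell m v)
  /\ (forall v, v \notin rwrites c -> realcell m' v = realcell m v).

Lemma agree_refl c m : agree c m m.
Proof. by []. Qed.

Lemma agree_trans c m1 m2 m3 : agree c m1 m2 -> agree c m2 m3 -> agree c m1 m3.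
Proof.
move=> [n12 r12] [n23 r23]; split=> v hv; first by rewrite n23 // n12.
by rewrite r23 // r12.
Qed.

Lemma agree_sub c c' m m' :
  {subset nwrites c <= nwrites c'} -> {subset rwrites c <= rwrites c'} ->
  agree c m m' -> agree c' m m'.
Proof.
move=> sn sr [an ar]; split=> v hv; first by apply: an; apply: contra hv => /sn.
by apply: ar; apply: contra hv => /sr.
Qed.

Lemma agree_nset c v ix a m : v \in nwrites c -> agree c m (nset v ix a m).
Proof.
move=> vc; split=> // w wc /=; rewrite /upd.
have -> : (w == v) = false by apply: contraNF wc => /eqP ->.
by [].
Qed.

Lemma agree_rset c v ix a m : v \in rwrites c -> agree c m (rset v ix a m).
Proof.
move=> vc; split=> // w wc /=; rewrite /upd.
have -> : (w == v) = false by apply: contraNF wc => /eqP ->.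
by [].
Qed.

Lemma final_seq c1 c2 m : final (Seq c1 c2) m = final c2 (final c1 m).
Proof. by []. Qed.

Lemma time_seq c1 c2 m :
  time (Seq c1 c2) m = (time c1 m + time c2 (final c1 m))%N.
Proof. by []. Qed.

Lemma final_if b c1 c2 m :
  final (If b c1 c2) m = if beval m b then final c1 m else final c2 m.
Proof. by rewrite /final /=; case: (beval m b). Qed.

(** * Loop invariants *)

Lemma for_rec v c1 m s a :
  let step (acc : nat * memory R) (i : nat) :=
    let r := run c1 (nset v [::] i acc.2) in ((acc.1 + r.1).+1, r.2) in
  (foldl step (a, m) s).2
  = foldl (fun m i => final c1 (nset v [::] i m)) m s.
Proof. by elim: s a m => //= i s IH a m; rewrite IH. Qed.

Lemma final_for v e c1 m :
  final (For v e c1) m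
  = foldl (fun m i => final c1 (nset v [::] i m)) m (iota 0 (neval m e)).
Proof. exact: for_rec. Qed.

Lemma for_ind (I : nat -> memory R -> Prop) v e c1 m :
  I 0%N m ->
  (forall i m', (i < neval m e)%N -> I i m' ->
     I i.+1 (final c1 (nset v [::] i m'))) ->
  I (neval m e) (final (For v e c1) m).
Proof.
move=> I0 IS; rewrite final_for.
have: (neval m e <= neval m e)%N by [].
(* Induction on the number of iterations already run; the occurrence left alone keeps the true bound
   for [IS]. *)
elim: {1 3 4}(neval m e) => [|k IH] kn //.
rewrite -[in iota _ _]addn1 iotaD cats1 foldl_rcons.
by apply: IS => //; apply/IH/ltnW.
Qed.

Lemma agree_final c m : agree c m (final c m).
Proof.
elim: c m => [|v ix e|v ix e|c1 IH1 c2 IH2|b c1 IH1 c2 IH2|v e c1 IH] m.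
- exact: agree_refl.
- by apply: agree_nset; rewrite /= mem_head.
- by apply: agree_rset; rewrite /= mem_head.
- rewrite final_seq; apply: (@agree_trans _ _ (final c1 m)).
    by apply: agree_sub (IH1 m) => w wc; rewrite /= mem_cat wc.
  by apply: agree_sub (IH2 _) => w wc; rewrite /= mem_cat wc orbT.
- rewrite final_if; case: (beval m b).
    by apply: agree_sub (IH1 m) => w wc; rewrite /= mem_cat wc.
  by apply: agree_sub (IH2 _) => w wc; rewrite /= mem_cat wc orbT.
apply: (@for_ind (fun _ m' => agree (For v e c1) m m')) => // i m' _ ag.
apply: (agree_trans ag); apply: (@agree_trans _ _ (nset v [::] i m')).
  by apply: agree_nset; rewrite /= mem_head.
by apply: agree_sub (IH _) => w wc //=; rewrite inE wc orbT.
Qed.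

(** The frame of the whole loop is itself invariant, so it is available to the step at no cost. *)
Lemma for_agree_ind (I : nat -> memory R -> Prop) v e c1 m :
  I 0%N m ->
  (forall i m', (i < neval m e)%N -> agree (For v e c1) m m' -> I i m' ->
     I i.+1 (final c1 (nset v [::] i m'))) ->
  I (neval m e) (final (For v e c1) m).
Proof.
move=> I0 IS.
pose J i m' := agree (For v e c1) m m' /\ I i m'.
suff: J (neval m e) (final (For v e c1) m) by case.
apply: for_ind => // i m' ie [ag Ii]; split; last exact: IS.
apply: (agree_trans ag); apply: (@agree_trans _ _ (nset v [::] i m')).
  by apply: agree_nset; rewrite /= mem_head.
by apply: agree_sub (agree_final c1 _) => w wc //=; rewrite inE wc orbT.
Qed.

(** * Nested loops that fill an array *)

Fixpoint nest (loops : seq (nat * nexp)) c : cmd :=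
  if loops is (v, e) :: loops' then For v e (nest loops' c) else c.

Definition inbox (bnd ix : seq nat) : bool :=
  (size ix == size bnd) && all2 (fun i b => i < b)%N ix bnd.

Lemma nwrites_nest ls c : nwrites (nest ls c) = map fst ls ++ nwrites c.
Proof. by elim: ls => [|[v e] ls IH] //=; rewrite IH. Qed.

Lemma rwrites_nest ls c : rwrites (nest ls c) = rwrites c.
Proof. by elim: ls => [|[v e] ls IH] //=. Qed.

(* [get] is the array being filled; the loop over [pre] is already running. *)
Lemma nest_fill_rec (X : Type) (get : memory R -> seq nat -> X) (f : seq nat -> X)
    (ls : seq (nat * nexp)) (bnd pre : seq nat) c m :
  (forall m' v i ix, v \in map fst ls -> get (nset v [::] i m') ix = get m' ix) ->
  uniq (map fst ls) -> all (fun v => v \notin nwrites c) (map fst ls) ->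
  (forall m', agree (nest ls c) m m' ->
     [seq neval m' l.2 | l <- ls] = bnd) ->
  (forall m' ix, agree (nest ls c) m m' -> inbox bnd ix ->
     [seq natcell m' l.1 [::] | l <- ls] = ix ->
     forall ad, get (final c m') ad
       = if ad == pre ++ ix then f (pre ++ ix) else get m' ad) ->
  forall ad, get (final (nest ls c) m) ad
    = if (take (size pre) ad == pre) && inbox bnd (drop (size pre) ad)
      then f ad else get m ad.
Proof.
elim: ls bnd pre m => [|[v e] ls IH] bnd pre m getv uls cls hb hc ad.
  have /= bE := hb m (agree_refl _ _); subst bnd.
  rewrite /= (hc m [::]) // cats0 /inbox /= size_drop subn_eq0.
  have [->|ne] := eqVneq ad pre; first by rewrite take_size drop_size leqnn eqxx.
  case: (leqP (size ad) (size pre)) => h; last by rewrite andbF.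
  by rewrite take_oversize // (negPf ne).
rewrite /=.
move: uls cls => /=/andP[vls uls] /andP[vc cls].
have [b bE [bnd' bE']] : exists2 b, b = neval m e & exists bnd', bnd = b :: bnd'.
  exists (neval m e) => //.
  by have /= <- := hb m (agree_refl _ _); eexists.
subst bnd.
(* After [i] rounds, exactly the cells whose index after [pre] is below [i], with the remaining ones
   in the inner box, are filled. *)
pose I i m' := forall ad, get m' ad =
  if (take (size pre) ad == pre) && inbox (i :: bnd') (drop (size pre) ad)
  then f ad else get m ad.
suff: I (neval m e) (final (For v e (nest ls c)) m) by rewrite -bE; apply.
apply: for_agree_ind => [|i m' ie ag Ii].
  move=> ad'; rewrite /inbox; case: (drop _ _) => [|x s] /=; rewrite ?andbF //.
have vw : v \notin nwrites (nest ls c) by rewrite nwrites_nest mem_cat negb_or vls.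
have agi m2 : agree (nest ls c) (nset v [::] i m') m2 ->
    agree (nest ((v, e) :: ls) c) m m2.
  move=> ag2; apply: (agree_trans ag).
  apply: (@agree_trans _ _ (nset v [::] i m')).
    by apply: agree_nset; rewrite /= mem_head.
  by apply: agree_sub ag2 => w wc //=; rewrite inE wc orbT.
move=> ad'.
rewrite (IH bnd' (rcons pre i)) => //; first last.
- move=> m2 ix ag2 ixb mix ad2.
  rewrite (hc m2 (i :: ix)) ?cat_rcons //; first exact: agi.
    by move: ixb; rewrite /inbox /= eqSS bE ie.
  rewrite /= mix; congr (_ :: _).
  by rewrite (proj1 ag2) //= /upd !eqxx.
- move=> m2 ag2; have /= := hb m2 (agi _ ag2).
  by case.
- by move=> m2 w j ix wl; apply: getv; rewrite /= inE wl orbT.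
rewrite getv ?mem_head // Ii size_rcons.
(* An address no longer than [pre] lies in neither box, so it is untouched. *)
have [lad|lad] := ltnP (size pre) (size ad'); last first.
  rewrite take_oversize; last exact: leq_trans lad _.
  rewrite (take_oversize lad) !drop_oversize //; last exact: leq_trans lad _.
  rewrite /inbox /= andbF.
  case: eqP => [E|//].
  by move: lad; rewrite E size_rcons ltnn.
rewrite (take_nth 0%N) // !(@drop_nth _ 0%N (size pre) ad') //.
rewrite eqseq_rcons /inbox /= !eqSS.
set x := nth _ _ _; case: (take _ _ == _) => //=.
(* Index [x = i] was filled in this round, [x < i] in earlier ones. *)
rewrite ltnS [(x <= i)%N]leq_eqVlt.
have [->|//] := eqVneq x i.
by rewrite ltnn /= andbF.
Qed.

Lemma nest_fill (X : Type) (get : memory R -> seq nat -> X) (f : seq nat -> X)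
    (ls : seq (nat * nexp)) (bnd : seq nat) c m :
  (forall m' v i ix, v \in map fst ls -> get (nset v [::] i m') ix = get m' ix) ->
  uniq (map fst ls) -> all (fun v => v \notin nwrites c) (map fst ls) ->
  (forall m', agree (nest ls c) m m' ->
     [seq neval m' l.2 | l <- ls] = bnd) ->
  (forall m' ix, agree (nest ls c) m m' -> inbox bnd ix ->
     [seq natcell m' l.1 [::] | l <- ls] = ix ->
     forall ad, get (final c m') ad = if ad == ix then f ix else get m' ad) ->
  forall ix, inbox bnd ix -> get (final (nest ls c) m) ix = f ix.
Proof.
move=> getv uls cls hb hc ix ixb.
by rewrite (@nest_fill_rec _ get f ls bnd [::]) //= take0 drop0 ixb eqxx.
Qed.

(** * Polynomial bounds on the running time *)

Fixpoint loop_bound (prot : seq nat) (e : nexp) : bool :=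
  match e with
  | NConst _ => true
  | NGet v ix => (v \in prot) && nilp ix
  | NAdd e1 e2 => loop_bound prot e1 && loop_bound prot e2
  | NSub _ _ => false
  end.

Fixpoint npoly (e : nexp) : {poly nat} :=
  match e with
  | NConst k => k%:P
  | NGet _ _ => 'X
  | NAdd e1 e2 => npoly e1 + npoly e2
  | NSub e1 _ => npoly e1
  end.

(** Loop bounds are built from scalars in [prot], which are never written. A bound on these scalars
    at the start therefore holds throughout the run. *)
Fixpoint clocked (prot : seq nat) c : bool :=
  match c with
  | Skip => true
  | NSet v _ _ => v \notin prot
  | RSet _ _ _ => true
  | Seq c1 c2 => clocked prot c1 && clocked prot c2
  | If _ c1 c2 => clocked prot c1 && clocked prot c2
  | For v e c1 => [&& v \notin prot, loop_bound prot e & clocked prot c1]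
  end.

(** The variable stands for a common bound on the protected scalars. The sum over the two branches
    of a test replaces a maximum, so as to stay within polynomials. *)
Fixpoint tpoly c : {poly nat} :=
  match c with
  | Skip => 1%:P
  | NSet _ _ _ => 1%:P
  | RSet _ _ _ => 1%:P
  | Seq c1 c2 => tpoly c1 + tpoly c2
  | If _ c1 c2 => tpoly c1 + tpoly c2 + 1%:P
  | For _ e c1 => npoly e * (tpoly c1 + 1%:P) + 1%:P
  end.

Lemma neval_bound prot e m S :
  (forall v, v \in prot -> natcell m v [::] <= S)%N -> loop_bound prot e ->
  (neval m e <= (npoly e).[S])%N.
Proof.
move=> hS; elim: e => [k|v ix|e1 IH1 e2 IH2|//] /=; first by rewrite hornerC.
  by move=> /andP[vp /nilP ->]; rewrite hornerX; apply: hS.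
by move=> /andP[/IH1 h1 /IH2 h2]; rewrite hornerD; apply: leq_add.
Qed.

Lemma clocked_nwrites prot c v : clocked prot c -> v \in prot -> v \notin nwrites c.
Proof.
elim: c => [|w ix e|w ix e|c1 IH1 c2 IH2|b c1 IH1 c2 IH2|w e c1 IH] //=.
- by move=> wp vp; rewrite inE; apply: contraNneq wp => <-.
- by move=> /andP[h1 h2] vp; rewrite mem_cat negb_or IH1 // IH2.
- by move=> /andP[h1 h2] vp; rewrite mem_cat negb_or IH1 // IH2.
move=> /and3P[wp _ h1] vp; rewrite inE negb_or IH // andbT.
by apply: contraNneq wp => <-.
Qed.

Lemma time_bound prot c m S :
  (forall v, v \in prot -> natcell m v [::] <= S)%N -> clocked prot c ->
  (time c m <= (tpoly c).[S])%N.
Proof.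
elim: c m => [|v ix e|v ix e|c1 IH1 c2 IH2|b c1 IH1 c2 IH2|v e c1 IH] m hS.
- by rewrite /= hornerC.
- by rewrite /= hornerC.
- by rewrite /= hornerC.
- move=> /= /andP[h1 h2]; rewrite time_seq hornerD leq_add ?IH1 ?IH2 // => v vp.
  by rewrite (proj1 (agree_final c1 m)) ?hS // (clocked_nwrites h1).
- move=> /= /andP[h1 h2]; rewrite /time /= !hornerD hornerC.
  have h : forall c', (time c' m <= (tpoly c1).[S] + (tpoly c2).[S])%N ->
    ((run c' m).1.+1 <= (tpoly c1).[S] + (tpoly c2).[S] + 1)%N.
    by move=> c' h; rewrite addn1 ltnS.
  by case: (beval m b); apply: h;
    [apply: leq_trans (IH1 _ hS h1) (leq_addr _ _)
    |apply: leq_trans (IH2 _ hS h2) (leq_addl _ _)].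
move=> /= /and3P[vp eb h1]; rewrite /time /=.
rewrite hornerD hornerM hornerD !hornerC.
have [T hT] : exists T, T = (tpoly c1).[S] by exists (tpoly c1).[S].
rewrite -hT.
have eS := neval_bound hS eb.
apply: (@leq_trans (1 + neval m e * T.+1)%N); last first.
  change (1 + neval m e * T.+1 <= (npoly e).[S] * (T + 1) + 1)%N.
  by rewrite addnC addn1 [(T + 1)%N]addn1 addn1 ltnS leq_mul2r eS orbT.
(* Generalized over the accumulated cost and the memory; each iteration costs at most [T], plus one
   step for the loop itself. *)
suff H s a m' : (forall w, w \in prot -> natcell m' w [::] <= S)%N ->
   ((foldl (fun (acc : nat * memory R) (i : nat) =>
      ((acc.1 + (run c1 (nset v [::] i acc.2)).1).+1,
        (run c1 (nset v [::] i acc.2)).2)) (a, m') s).1 <= a + size s * T.+1)%N.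
  by apply: leq_trans (H _ _ _ hS) _; rewrite size_iota.
elim: s a m' => [|i s IHs] a m' hm' /=; first by rewrite addn0.
have hn w : w \in prot -> (natcell (nset v [::] i m') w [::] <= S)%N.
  move=> wp; rewrite /= /upd.
  have -> : (w == v) = false by apply: contraNF vp => /eqP <-.
  exact: hm'.
apply: leq_trans (IHs _ _ _) _.
  by move=> w wp; rewrite (proj1 (agree_final c1 _)) ?hn ?(clocked_nwrites h1).
have := IH _ hn h1; rewrite -hT /time; set t := (run _ _).1 => ht.
by rewrite mulSn addnA leq_add2r -addnS leq_add2l ltnS.
Qed.

(** Coefficients in [nat] are nonnegative. *)
Lemma horner_nat_mono (p : {poly nat}) (x y : nat) :
  (x <= y)%N -> (p.[x] <= p.[y])%N.
Proof.
move=> xy; elim/poly_ind: p => [|p c IH]; first by rewrite !horner0.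
rewrite !hornerD !hornerM !hornerX !hornerC.
by apply: leq_add => //; apply: leq_mul.
Qed.

End Machine.

(** * The graph *)

Section Sums.
Variable V : nmodType.

Lemma sum_divmod (a b : nat) (F : nat -> nat -> V) :
  (0 < b)%N ->
  \sum_(u < a * b) F (u %/ b)%N (u %% b)%N = \sum_(i < a) \sum_(j < b) F i j.
Proof.
move=> b0; rewrite -(big_mkord xpredT (fun u => F (u %/ b)%N (u %% b)%N)).
rewrite big_nat_mul big_mkord; apply: eq_bigr => i _.
rewrite mulSn -{1}[(i * b)%N]add0n big_addn addnK big_mkord.
apply: eq_bigr => j _.
by rewrite addnC divnMDl // modnMDl divn_small // modn_small // addn0.
Qed.

Lemma sum_trunc (a b : nat) (F : nat -> V) :
  (a <= b)%N -> (forall k, (a <= k)%N -> F k = 0) ->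
  \sum_(k < b) F k = \sum_(k < a) F k.
Proof.
move=> ab F0; rewrite (big_ord_widen _ F ab) [RHS]big_mkcond /=.
by apply: eq_bigr => k _; case: ltnP => // /F0.
Qed.

(** Turns the sum over unordered pairs in a clique weight into one over ordered pairs; with [f]
    constant, it counts edges. *)
Lemma double_sum_set (N : nat) (C : {set 'I_N}) (f : 'I_N -> 'I_N -> V) :
  \sum_(u in C) \sum_(w in C) f u w =
  \sum_(u in C) \sum_(w in C | (u < w)%N) (f u w + f w u) + \sum_(u in C) f u u.
Proof.
have E u : u \in C -> \sum_(w in C) f u w = \sum_(w in C | (u < w)%N) f u w
    + \sum_(w in C | (w < u)%N) f u w + f u u.
  move=> uC; rewrite (bigID (fun w : 'I_N => (u < w)%N)) /= -addrA; congr (_ + _).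
  rewrite (bigD1 u) ?uC ?ltnn //= addrC; congr (_ + _).
  apply: eq_bigl => w; rewrite -leqNgt ltn_neqAle -andbA.
  by rewrite [(w <= u)%N && _]andbC.
rewrite (eq_bigr _ E) !big_split /=; congr (_ + _).
under [RHS]eq_bigr do rewrite big_split.
rewrite big_split /=; congr (_ + _).
rewrite (exchange_big_dep (mem C)) /=; last by move=> i j _ /andP[].
by apply: eq_bigr => u uC; apply: eq_bigl => w; rewrite uC.
Qed.

End Sums.

Section Graph.
Variables (R : realType) (q : nat) (D : du R q).
Local Notation n := (heroes D).
Local Notation t := (alliances D).

(** The instance data are read off the input memory at arbitrary natural indices, with default zero
    out of range. The graph is thus defined from the same values that the programs see. *)
Definition mem (i j : nat) : bool := (0 < natcell (du_mem D) n_member [:: i; j])%N.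
Definition str (i : nat) : R := realcell (du_mem D) r_strength [:: i].
Definition bon (i j k : nat) : R := realcell (du_mem D) r_bonus [:: i; j; k].

Lemma extend_ord (T : Type) (z : T) (b : nat) (f : 'I_b -> T) (i : 'I_b) :
  extend z f i = f i.
Proof. by rewrite /extend valK. Qed.

Lemma extend_out (T : Type) (z : T) (b : nat) (f : 'I_b -> T) (i : nat) :
  (b <= i)%N -> extend z f i = z.
Proof. by move=> bi; rewrite /extend insubF // ltnNge bi. Qed.

Lemma mem_ord (i : 'I_n) (j : 'I_t) : mem i j = member D i j.
Proof. by rewrite /mem /= !extend_ord lt0b. Qed.

Lemma str_ord (i : 'I_n) : str i = strength D i.
Proof. by rewrite /str /= extend_ord. Qed.

Lemma bon_ord (i : 'I_n) (j : 'I_t) (k : 'I_q) : bon i j k = bonus D i j k.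
Proof. by rewrite /bon /= !extend_ord. Qed.

Lemma mem_out i j : mem i j -> (i < n)%N.
Proof. by rewrite /mem /=; case: (ltnP i n) => // h; rewrite extend_out. Qed.

Lemma str_out i : (n <= i)%N -> str i = 0.
Proof. by move=> h; rewrite /str /= extend_out. Qed.

Lemma bon_out i j k : (n <= i)%N || (q <= k)%N -> bon i j k = 0.
Proof.
rewrite /bon /=; case: (ltnP i n) => [ni /= h|h _]; last by rewrite extend_out.
rewrite -[i]/(val (Ordinal ni)) extend_ord.
case: (ltnP j t) => [jt|h']; last by rewrite extend_out.
by rewrite -[j]/(val (Ordinal jt)) extend_ord extend_out.
Qed.

(* A vertex is a triple (g, k, v): the variable (g, k) takes the value v <= n.
   For g < t and k < q, v = i + 1 says that hero i is the witness number k for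
   alliance g, and a value v > 0 stands for "alliance g reaches threshold k + 1".
   For g = t and k < n, v > 0 says that hero k occupies place v of the team.
   The other variables are constrained to be 0; (t, n) among them carries the
   strengths. There are at least two variables, so that adding one to a clique
   creates an edge. *)
Definition width := (n + q).+2.
Definition nclass := (t.+1 * width)%N.
Definition order := (nclass * n.+1)%N.
Definition gof (u : nat) := (u %/ n.+1 %/ width)%N.
Definition kof (u : nat) := ((u %/ n.+1) %% width)%N.
Definition vof (u : nat) := (u %% n.+1)%N.
Definition code (g k v : nat) := ((g * width + k) * n.+1 + v)%N.

Lemma vof_code g k v : (v <= n)%N -> vof (code g k v) = v.
Proof. by move=> vn; rewrite /vof /code modnMDl modn_small. Qed.

Lemma kof_code g k v : (k < width)%N -> (v <= n)%N -> kof (code g k v) = k.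
Proof.
by move=> kw vn; rewrite /kof /code divnMDl // divn_small // addn0 modnMDl modn_small.
Qed.

Lemma gof_code g k v : (k < width)%N -> (v <= n)%N -> gof (code g k v) = g.
Proof.
move=> kw vn; rewrite /gof /code divnMDl // [(v %/ _)%N]divn_small // addn0.
by rewrite divnMDl // divn_small // addn0.
Qed.

Lemma code_lt g k v : (g <= t)%N -> (k < width)%N -> (v <= n)%N -> (code g k v < order)%N.
Proof.
move=> gt kw vn; rewrite /code /order.
apply: (@leq_trans ((g * width + k).+1 * n.+1)%N).
  by rewrite mulSn addnC ltn_add2r ltnS.
rewrite leq_mul2r /= /nclass; apply: (@leq_trans (g.+1 * width)%N).
  by rewrite mulSn addnC ltn_add2r.
by rewrite leq_mul2r ltnS gt orbT.
Qed.

Lemma gof_le u : (u < order)%N -> (gof u <= t)%N.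
Proof. by move=> h; rewrite -ltnS /gof !ltn_divLR. Qed.

Lemma kof_lt u : (kof u < width)%N.
Proof. exact: ltn_pmod. Qed.

Lemma vof_le u : (vof u <= n)%N.
Proof. by rewrite -ltnS; apply: ltn_pmod. Qed.

Lemma vertex_inj u w : gof u = gof w -> kof u = kof w -> vof u = vof w -> u = w.
Proof.
rewrite /gof /kof /vof => hg hk hv.
rewrite (divn_eq u n.+1) (divn_eq w n.+1) hv; congr (_ * _ + _)%N.
by rewrite (divn_eq (u %/ _) width) hg hk -divn_eq.
Qed.

(** * Edges and weights *)

Definition ok (g k v : nat) : bool :=
  [|| v <= 0, [&& g < t, k < q & mem v.-1 g] | [&& t <= g, k < n & v <= team_max D]]%N.

(** The case [k == k'] keeps two values of one variable apart; the other makes places and witnesses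
    distinct, while 0 may repeat. *)
Definition excl (g k v g' k' v' : nat) : bool :=
  ~~ ((g == g') && ((k == k') || ((v == v') && (0 < v)%N))).

(** The two forbidden patterns are a missing witness below a present one, and a witness whose hero
    [v.-1] has no place in the team. *)
Definition req (g k v g' k' v' : nat) : bool :=
  ~~ [&& g < t, 0 < v, v' <= 0
       & ((g == g') && (k' < k)) || ((t <= g') && (v == k'.+1))]%N.

Definition compat (g k v g' k' v' : nat) : bool :=
  [&& ok g k v, ok g' k' v', excl g k v g' k' v', req g k v g' k' v'
    & req g' k' v' g k v].

(** Only edges carry weight, so a strength is put on the edge to [(t, n)], a variable that can only
    be 0 and occurs in every full assignment. A negative bonus gains 0 because its indicator may be
    left at 0. *)
Definition gain (g k v g' k' v' : nat) : R :=
  if ((t <= g) && (0 < v))%N then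
    if (g' < t)%N then
      if (0 < v')%N && (0 <= bon k g' k') then bon k g' k' else 0
    else if k' == n then str k else 0
  else 0.

Definition edge_at (u w : nat) : bool :=
  compat (gof u) (kof u) (vof u) (gof w) (kof w) (vof w).

Definition gain_at (u w : nat) : R :=
  gain (gof u) (kof u) (vof u) (gof w) (kof w) (vof w).

Definition gain_total : R := \sum_(u < order) \sum_(w < order) `|gain_at u w|.

(** The gains of two cliques differ by at most [gain_total *+ 2], so a single prize outweighs them;
    the 1 keeps this strict when all gains vanish. The factor 4 is reached by two doublings, without
    multiplication. *)
Definition edge_prize : R := 1 + gain_total *+ 4.

Definition weight_at (u w : nat) : R := gain_at u w + gain_at w u + edge_prize.

Lemma compat_sym g k v g' k' v' : compat g k v g' k' v' = compat g' k' v' g k v.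
Proof.
rewrite /compat; have -> : excl g k v g' k' v' = excl g' k' v' g k v.
  rewrite /excl ![_ == g']eq_sym ![_ == k']eq_sym ![_ == v']eq_sym.
  by have [->|] := eqVneq v' v.
by rewrite andbCA; do 3 congr (_ && _); rewrite andbC.
Qed.

Lemma edge_at_sym : symmetric (fun u w : 'I_order => edge_at u w).
Proof. by move=> u w; apply: compat_sym. Qed.

Lemma edge_at_irr : irreflexive (fun u w : 'I_order => edge_at u w).
Proof. by move=> u; rewrite /edge_at /compat /excl !eqxx /= !andbF. Qed.

Lemma weight_at_sym (u w : 'I_order) : weight_at u w = weight_at w u.
Proof. by rewrite /weight_at [gain_at u w + _]addrC. Qed.

Definition graph : wgraph R :=
  WGraph edge_at_sym edge_at_irr weight_at_sym.

(** * Weight and size of cliques *)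

Definition total_gain (C : {set 'I_order}) : R :=
  \sum_(u in C) \sum_(w in C) gain_at u w.

(** The only case that is not zero by definition reads the strength of a hero [n], which is out of
    range. *)
Lemma gain_at_diag u : gain_at u u = 0.
Proof.
rewrite /gain_at /gain; case: ifP => // /andP[gt _].
by rewrite ltnNge gt /=; case: eqP => // ->; rewrite str_out.
Qed.

Lemma gain_total_ge0 : 0 <= gain_total.
Proof. by apply: sumr_ge0 => u _; apply: sumr_ge0. Qed.

Lemma total_gain_le C : `|total_gain C| <= gain_total.
Proof.
rewrite /total_gain big_mkcond; apply: le_trans (ler_norm_sum _ _ _) _.
apply: ler_sum => u _; case: ifP => _; last by rewrite normr0 sumr_ge0.
rewrite big_mkcond; apply: le_trans (ler_norm_sum _ _ _) _.
by apply: ler_sum => w _; case: ifP => _ //; rewrite normr0.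
Qed.

(** The prizes depend on the cardinality alone. Doubling avoids dividing the number of ordered pairs
    by two. *)
Lemma clique_weightE (C : {set 'I_order}) :
  clique_weight graph C *+ 2
  = edge_prize * ((#|C| * #|C|)%:R - #|C|%:R) + total_gain C *+ 2.
Proof.
have -> : clique_weight graph C = total_gain C
    + \sum_(u in C) \sum_(w in C | (u < w)%N) edge_prize.
  rewrite /clique_weight /= /weight_at /total_gain double_sum_set.
  rewrite [X in _ + X + _]big1 ?addr0; last by move=> u _; apply: gain_at_diag.
  by rewrite -big_split; apply: eq_bigr => u _; rewrite -big_split.
have := double_sum_set C (fun _ _ => edge_prize).
under eq_bigr do rewrite sumr_const.
rewrite !sumr_const -mulrnA.
under [X in _ = X + _]eq_bigr do rewrite big_split.
rewrite big_split /=.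
set P := \sum_(u in C) _ => E.
rewrite mulrnDl addrC; congr (_ + _).
by rewrite mulrBr !mulr_natr E mulr2n addrK.
Qed.

Lemma clique_class_inj (C : {set 'I_order}) u w :
  clique graph C -> u \in C -> w \in C -> gof u = gof w -> kof u = kof w -> u = w.
Proof.
move=> hC uC wC hg hk; apply/eqP/negPn/negP => ne.
have /= := hC u w uC wC ne; rewrite /edge_at /compat /excl hg hk !eqxx /=.
by rewrite !andbF.
Qed.

(** A clique has at most one vertex per variable; [u %/ n.+1] is the number of the variable of
    [u]. *)
Lemma clique_card_le (C : {set 'I_order}) : clique graph C -> (#|C| <= nclass)%N.
Proof.
move=> hC.
have cl (u : 'I_order) : (u %/ n.+1 < nclass)%N by rewrite ltn_divLR.
rewrite -[X in (_ <= X)%N](card_ord nclass).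
rewrite -(card_in_imset (f := fun u => Ordinal (cl u))); first exact: max_card.
move=> u w uC wC [E]; apply: (clique_class_inj hC) => //.
  by rewrite /gof E.
by rewrite /kof E.
Qed.

(** * Full assignments as sets of vertices *)

Section Assignment.
Variable z : nat -> nat -> nat.
Hypothesis z_le : forall g k, (z g k <= n)%N.

Definition assigned : {set 'I_order} := [set u : 'I_order | vof u == z (gof u) (kof u)].

Lemma sum_assigned (V : nmodType) (F : nat -> nat -> nat -> V) :
  \sum_(u in assigned) F (gof u) (kof u) (vof u)
  = \sum_(g < t.+1) \sum_(k < width) F g k (z g k).
Proof.
rewrite big_mkcond /=.
(* Dividing twice turns the sum over vertices into one over triples; for each variable a single
   value survives. *)
pose G c v := if v == z (c %/ width)%N (c %% width)%N
  then F (c %/ width)%N (c %% width)%N v else 0.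
transitivity (\sum_(u < nclass * n.+1) G (u %/ n.+1)%N (u %% n.+1)%N).
  by apply: eq_bigr => u _; rewrite inE.
rewrite sum_divmod // /nclass.
pose G' g k := \sum_(v < n.+1) if v == z g k :> nat then F g k v else 0.
rewrite (sum_divmod _ G') //.
apply: eq_bigr => g _; apply: eq_bigr => k _.
rewrite /G' -big_mkcond /= (big_pred1 (inord (z g k))) ?inordK ?ltnS //.
by move=> v /=; rewrite -val_eqE /= inordK ?ltnS.
Qed.

Lemma card_assigned : #|assigned| = nclass.
Proof.
rewrite -sum1_card (sum_assigned (fun _ _ _ => 1%N)).
by rewrite !sum_nat_const !card_ord muln1.
Qed.

Definition consistent : Prop :=
  forall g k g' k', (g <= t)%N -> (k < width)%N -> (g' <= t)%N -> (k' < width)%N ->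
    (g != g') || (k != k') -> compat g k (z g k) g' k' (z g' k').

Lemma clique_assigned : clique graph assigned <-> consistent.
Proof.
split=> [hC g k g' k' hg hk hg' hk' ne|hz u w].
  pose u := Ordinal (code_lt hg hk (z_le g k)).
  pose w := Ordinal (code_lt hg' hk' (z_le g' k')).
  have := hC u w; rewrite !inE /= /edge_at /= !gof_code // !kof_code // !vof_code //.
  rewrite !eqxx; apply=> //; apply: contraTneq ne => uw.
  have gg : gof u = gof w by rewrite uw.
  have kk : kof u = kof w by rewrite uw.
  by move: gg kk; rewrite /= !gof_code // !kof_code // => -> ->; rewrite !eqxx.
rewrite !inE => /eqP hu /eqP hw ne /=; rewrite /edge_at hu hw.
apply: hz; rewrite ?gof_le ?kof_lt //; rewrite -negb_and; apply: contra ne.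
move=> /andP[/eqP gg /eqP kk]; apply/eqP/val_inj/vertex_inj => //.
by rewrite hu hw gg kk.
Qed.

Lemma total_gain_assigned :
  total_gain assigned = \sum_(i < n) (if (0 < z t i)%N then str i else 0)
    + \sum_(i < n) \sum_(j < t) \sum_(k < q)
        (if [&& 0 < z t i, 0 < z j k & (0 <= bon i j k)%R]%N then bon i j k else 0).
Proof.
rewrite /total_gain.
under eq_bigr do rewrite (sum_assigned (gain _ _ _)).
rewrite (sum_assigned (fun g k v => \sum_(g' < t.+1) \sum_(k' < width)
   gain g k v g' k' (z g' k'))).
(* Gains are directed from place variables, [g = t], so the alliance groups contribute nothing as
   sources. *)
rewrite big_ord_recr /= big1 ?add0r; last first.
  move=> g _; apply: big1 => k _; apply: big1 => g' _; apply: big1 => k' _.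
  by rewrite /gain leqNgt ltn_ord.
pose F k := (if (0 < z t k)%N then str k else 0)
  + \sum_(j < t) \sum_(k' < q)
      (if [&& 0 < z t k, 0 < z j k' & (0 <= bon k j k')%R]%N then bon k j k' else 0).
transitivity (\sum_(k < width) F k).
  apply: eq_bigr => k _; rewrite big_ord_recr /= addrC; congr (_ + _).
    have hn : (n < width)%N by rewrite /width ltnS leqW // leq_addr.
    (* Within group [t] only the target [(t, n)] yields a gain, the strength. *)
    rewrite (bigD1 (Ordinal hn)) //= big1 ?addr0.
      by rewrite /gain leqnn ltnn eqxx.
    move=> k'; rewrite -val_eqE /= /gain ltnn => /negPf ->.
    by case: ifP.
  apply: eq_bigr => j _.
  pose G k' :=
    if [&& 0 < z t k, 0 < z j k' & (0 <= bon k j k')%R]%N then bon k j k' else 0.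
  have -> : \sum_(k' < q) G k' = \sum_(k' < width) G k'.
    rewrite (@sum_trunc _ q width) // => [|k' qk].
      by rewrite /width; lia.
    by rewrite /G bon_out ?qk ?orbT // if_same.
  by apply: eq_bigr => k' _; rewrite /gain leqnn ltn_ord /G; case: (0 < z t k)%N.
(* Indices [k] from [n] on are no heroes: their strengths and bonuses are the default 0. *)
rewrite (@sum_trunc _ n width) => [|/=|k nk]; first exact: big_split.
  by rewrite /width; lia.
rewrite /F str_out // if_same add0r; apply: big1 => j _; apply: big1 => k' _.
by rewrite bon_out ?nk // if_same.
Qed.

End Assignment.

(** * Maximum cliques are full assignments *)

Lemma consistent0 : consistent (fun _ _ => 0%N).
Proof.
move=> g k g' k' _ _ _ _ ne.
rewrite /compat /ok /= /excl /req ltnn !andbF /= !andbT !orbF.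
by rewrite negb_and.
Qed.

(** The empty team is a clique with [nclass] vertices. A smaller clique has at least one edge fewer,
    and the lost prize exceeds any advantage in gains. *)
Lemma max_clique_card (C : {set 'I_order}) : max_clique graph C -> #|C| = nclass.
Proof.
move=> [hC mC]; apply/eqP; rewrite eqn_leq clique_card_le //= leqNgt; apply/negP => lt.
have cl0 : clique graph (assigned (fun _ _ => 0%N)).
  by apply/clique_assigned => //; apply: consistent0.
have := mC _ cl0; apply/negP; rewrite -ltNge.
rewrite -(@ltr_pMn2r _ 2) // !clique_weightE card_assigned //.
set C0 := assigned _.
have := total_gain_le C; have := total_gain_le C0; have := gain_total_ge0.
rewrite !ler_norml /edge_prize.
move: (total_gain C) (total_gain C0) gain_total => a b W W0 /andP[b1 b2] /andP[a1 a2].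
(* With a single variable, the empty clique and a one-vertex clique would weigh the same. *)
have n2 : (2 <= nclass)%N by rewrite /nclass /width mulSn addSn ltnS.
move: nclass #|C| lt n2 => N c cN N2.
(* One missing edge, counted twice. *)
have h1 : 2 <= (N * N)%:R - N%:R - ((c * c)%:R - c%:R) :> R.
  have : (c * c + N + 2 <= N * N + c)%N by nia.
  by rewrite -(ler_nat R) !natrD; lra.
nra.
Qed.

(** In a clique the maximum ranges over at most one vertex, so it merely extracts the value, giving
    0 when there is none. *)
Definition assignment_of (C : {set 'I_order}) (g k : nat) : nat :=
  \max_(u in C | (gof u == g) && (kof u == k)) vof u.

Lemma assignment_of_le C g k : (assignment_of C g k <= n)%N.
Proof. by apply/bigmax_leqP => u _; apply: vof_le. Qed.

Lemma assignment_of_gt0 (C : {set 'I_order}) g k :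
  (0 < assignment_of C g k)%N
  <-> exists2 u : 'I_order, u \in C & [/\ gof u = g, kof u = k & (0 < vof u)%N].
Proof.
split=> [|[u uC [gu ku vu]]]; last first.
  apply: leq_trans vu _; rewrite /assignment_of.
  by apply: (@leq_bigmax_cond _ _ (fun u : 'I_order => vof u)); rewrite uC gu ku !eqxx.
rewrite lt0n => h.
have [/existsP[u /and3P[uC /andP[/eqP gu /eqP ku] vu]]|] := boolP
  [exists u : 'I_order, [&& u \in C, (gof u == g) && (kof u == k) & (0 < vof u)%N]].
  by exists u.
rewrite negb_exists => /forallP hu; case/negP: h; rewrite -leqn0.
apply/bigmax_leqP => u /andP[uC gk]; have := hu u.
by rewrite uC gk /= -leqNgt.
Qed.

(** Inclusion holds since each variable occurs at most once in [C], and the cardinalities agree. *)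
Lemma max_clique_assigned C : max_clique graph C -> C = assigned (assignment_of C).
Proof.
move=> mC; apply/eqP; rewrite eqEcard card_assigned; last exact: assignment_of_le.
rewrite (max_clique_card mC) leqnn andbT; apply/subsetP => u uC.
rewrite inE /assignment_of (big_pred1 u) // => w /=.
apply/idP/eqP => [/andP[wC /andP[/eqP gg /eqP kk]]|->]; last by rewrite uC !eqxx.
exact: (clique_class_inj (proj1 mC)).
Qed.

End Graph.

(** * Teams and consistent assignments *)

Section Teams.
Variables (R : realType) (q : nat) (M : R) (D : du R q).
Hypothesis hM : q%:R < M.
Local Notation n := (heroes D).
Local Notation t := (alliances D).

Lemma sum_count (b : nat) (P : pred nat) : (\sum_(i < b) P i)%N = count P (iota 0 b).
Proof.
rewrite -(big_mkord xpredT (fun i => nat_of_bool (P i))) /index_iota subn0.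
by rewrite -sum1_count [RHS]big_mkcond; apply: eq_bigr => i _; case: (P i).
Qed.

Lemma count_members (x : pred nat) (j : 'I_t) :
  \sum_(i < n) (member D i j)%:R * (x i)%:R
  = (count (fun i => x i && mem D i j) (iota 0 n))%:R :> R.
Proof.
rewrite -sum_count natr_sum; apply: eq_bigr => i _.
by rewrite mem_ord -natrM mulnb andbC.
Qed.

(** * From consistent assignments to feasible teams *)

Section Sound.
Variable z : nat -> nat -> nat.
Hypothesis z_le : forall g k, (z g k <= n)%N.
Hypothesis hz : consistent D z.

Definition team_of : du_team D := fun i => (0 < z t i)%N.
Definition active_of : du_active D := fun i j k =>
  [&& (0 < z t i)%N, (0 < z j k)%N & 0 <= bon D i j k].

Lemma ok_consistent g k : (g <= t)%N -> (k < width D)%N -> ok D g k (z g k).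
Proof.
(* Consistency only concerns two distinct variables. The partner has index 1 if [k = 0] and 0
   otherwise, which exists because [width] is at least 2. *)
move=> hg hk; have := hz (k' := (k == 0%N)) hg hk hg.
rewrite eqxx /=; case: (k == 0%N) / eqP => [->|/eqP ne].
  by move/(_ isT isT) => /and5P[].
by rewrite ne; move/(_ isT isT) => /and5P[].
Qed.

Lemma consistent_inj g k k' : (g <= t)%N -> (k < width D)%N -> (k' < width D)%N ->
  (0 < z g k)%N -> z g k = z g k' -> k = k'.
Proof.
move=> hg hk hk' z0 E; apply/eqP/negPn/negP => ne.
have := hz hg hk hg hk'; rewrite eqxx ne => /(_ isT) /and5P[_ _].
by rewrite /excl eqxx -E eqxx z0 orbT.
Qed.

(** Team members hold distinct places between 1 and [team_max D]. *)
Lemma consistent_team_size : (\sum_i team_of i <= team_max D)%N.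
Proof.
rewrite (sum_count n (fun i => 0 < z t i)%N) -size_filter.
rewrite -(size_map (z t)) -[X in (_ <= X)%N](size_iota 1).
have nw i : (i < n)%N -> (i < width D)%N by rewrite /width; lia.
apply: uniq_leq_size => [|v /mapP[i]].
  rewrite map_inj_in_uniq ?filter_uniq ?iota_uniq // => i i'.
  rewrite !mem_filter !mem_iota /= => /andP[i0 iN] /andP[_ iN'].
  by apply: consistent_inj => //; apply: nw.
rewrite mem_filter mem_iota /= => /andP[i0 iN] ->.
have := ok_consistent (leqnn t) (nw _ iN).
rewrite /ok leqNgt i0 ltnn leqnn /= iN /= => h.
by rewrite mem_iota i0 add1n ltnS.
Qed.

(** The thresholds with indices 0 to [k] have [k.+1] distinct witnesses, each a member of [j] in the
    team. *)
Lemma consistent_witnesses (j : 'I_t) (k : 'I_q) : (0 < z j k)%N ->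
  (k < count (fun i => (0 < z t i) && mem D i j) (iota 0 n))%N.
Proof.
move=> zk.
have kw (k' : nat) : (k' <= k)%N -> (k' < width D)%N.
  by rewrite /width; have := ltn_ord k; lia.
have zk' (k' : nat) : (k' <= k)%N -> (0 < z j k')%N.
  rewrite leq_eqVlt => /orP[/eqP -> //|lt].
  have := @hz j k j k' (ltnW (ltn_ord j)) (kw _ (leqnn _)) (ltnW (ltn_ord j))
    (kw _ (ltnW lt)).
  rewrite eqxx (gtn_eqF lt) => /(_ isT) /and5P[_ _ _].
  by rewrite /req ltn_ord zk eqxx lt /= andbT lt0n leqn0.
(* Heroes are shifted by [S] because the value [i.+1] encodes hero [i]. *)
rewrite -size_filter -(size_map S) -(size_iota 0 k.+1) -(size_map (z j)).
apply: uniq_leq_size => [|v /mapP[k']].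
  rewrite map_inj_in_uniq ?iota_uniq // => k1 k2.
  rewrite !mem_iota /= add0n !ltnS => h1 h2.
  by apply: consistent_inj; rewrite ?kw ?zk' // ltnW.
rewrite mem_iota /= add0n ltnS => hk ->.
have z0 := zk' _ hk.
have := ok_consistent (ltnW (ltn_ord j)) (kw _ hk).
rewrite /ok leqNgt z0 ltn_ord /= [(t <= j)%N]leqNgt ltn_ord orbF => /andP[_ hm].
have iN := mem_out hm.
have nw : ((z j k').-1 < width D)%N by rewrite /width; lia.
have jt : (j : nat) != t by rewrite ltn_eqF.
(* Compatibility with the place variable of the witness puts that hero in the team. *)
have := hz (ltnW (ltn_ord j)) (kw _ hk) (leqnn t) nw.
rewrite jt => /(_ isT) /and5P[_ _ _].
rewrite /req ltn_ord z0 leqnn /= (prednK z0) eqxx orbT andbT => h _.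
rewrite -(prednK z0); apply: map_f; rewrite mem_filter hm mem_iota iN.
by rewrite lt0n -leqn0 h.
Qed.

Lemma consistent_feasible : du_feasible M D team_of active_of.
Proof.
split=> [|i j k|i j k]; first exact: consistent_team_size.
  by rewrite /active_of /team_of; case: (0 < z t i)%N; rewrite /= ?leq_b1.
rewrite (count_members (fun i => 0 < z t i)%N).
case: (boolP (active_of i j k)) => [/and3P[_ zjk _]|_].
  by rewrite subrr mulr0 subr_ge0 ler_nat; apply: consistent_witnesses.
(* An inactive indicator leaves a vacuous constraint: the threshold is at most [q], which is below
   [M]. *)
rewrite sub0r mulrN1 lerBrDr.
apply: (@le_trans _ _ 0); last exact: ler0n.
rewrite addrC subr_le0; apply: le_trans (ltW hM).
by rewrite ler_nat.
Qed.

Lemma consistent_objective :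
  du_objective D team_of active_of = total_gain (assigned D z).
Proof.
rewrite total_gain_assigned // /du_objective; congr (_ + _).
  apply: eq_bigr => i _; rewrite /team_of str_ord.
  by case: ifP => _; rewrite ?mul1r ?mul0r.
apply: eq_bigr => i _; apply: eq_bigr => j _; apply: eq_bigr => k _.
rewrite /active_of bon_ord.
by case: ifP => _; rewrite ?mulr1 ?mulr0.
Qed.

End Sound.

(** * From feasible teams to consistent assignments *)

Section Complete.
Variables (x : du_team D) (y : du_active D).
Hypothesis hxy : du_feasible M D x y.

Let xx (i : nat) : bool := extend false x i.
Let team := [seq i <- iota 0 n | xx i].
Let members (j : nat) := [seq i <- iota 0 n | xx i && mem D i j].

(** Members of the team and of each alliance are listed in increasing order, and positions in these
    lists supply places and witnesses. The indicators [y] are ignored: every reached threshold gets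
    a witness. *)
Definition assignment_for (g k : nat) : nat :=
  if (g < t)%N then
    if (k < q)%N && (k < size (members g))%N then (nth 0%N (members g) k).+1 else 0%N
  else if xx k then (index k team).+1 else 0%N.

Let xx_lt k : xx k -> (k < n)%N.
Proof. by rewrite /xx; case: (ltnP k n) => // h; rewrite extend_out. Qed.

Let team_index k : xx k -> (index k team < size team)%N.
Proof. by move=> xk; rewrite index_mem mem_filter xk mem_iota /= add0n xx_lt. Qed.

Let member_nth g k : (k < size (members g))%N ->
  [/\ xx (nth 0%N (members g) k), mem D (nth 0%N (members g) k) g
    & (nth 0%N (members g) k < n)%N].
Proof.
move=> h; have := mem_nth 0%N h; rewrite mem_filter mem_iota /= add0n.
by move=> /andP[/andP[]].
Qed.

Lemma assignment_for_le g k : (assignment_for g k <= n)%N.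
Proof.
rewrite /assignment_for; case: ifP => _; case: ifP => //.
  by move=> /andP[_ /member_nth[]].
move=> /team_index h; apply: leq_trans h _.
by rewrite size_filter -[X in (_ <= X)%N](size_iota 0 n) count_size.
Qed.

Lemma team_size : (size team <= team_max D)%N.
Proof.
case: hxy => h _ _; rewrite size_filter -sum_count.
by under eq_bigr do rewrite /xx extend_ord.
Qed.

Lemma assignment_for_consistent : consistent D assignment_for.
Proof.
have okz g k : (g <= t)%N -> ok D g k (assignment_for g k).
  move=> gt; rewrite /ok /assignment_for; case: ltnP => tg.
    case: ifP => //= /andP[-> /member_nth[_ -> _]].
    by rewrite orTb.
  case: ifP => //= xk; rewrite xx_lt //=.
  exact: leq_trans (team_index xk) team_size.
have reqz g k g' k' : (g' <= t)%N ->
    req D g k (assignment_for g k) g' k' (assignment_for g' k').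
  move=> gt'; rewrite /req; apply/negP => /and4P[gt v0 v'0 /orP[/andP[/eqP E lt]|]].
    move: v0 v'0; rewrite -E /assignment_for gt; case: ifP => // /andP[kq ks] _.
    by rewrite (ltn_trans lt kq) (ltn_trans lt ks).
  move=> /andP[tg' /eqP E].
  move: v0 v'0 E; rewrite /assignment_for gt [(g' < t)%N]ltnNge tg' /=.
  case: ifP => // /andP[_ /member_nth[xn _ _]] _ h [E]; move: h.
  by rewrite -E xn.
move=> g k g' k' gt _ gt' _ ne; rewrite /compat !okz // !reqz // !andbT.
rewrite /excl; apply/negP => /andP[/eqP E]; move: ne; rewrite -E eqxx /= => nk.
rewrite (negPf nk) /= => /andP[/eqP]; rewrite /assignment_for.
case: ifP => _.
  case: ifP => // /andP[_ ks]; case: ifP => // /andP[_ ks'] [/eqP].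
  by rewrite nth_uniq ?filter_uniq ?iota_uniq // (negPf nk).
case: ifP => // xk; case: ifP => // xk' [Ei] _.
have kt : k \in team by rewrite -index_mem team_index.
have kt' : k' \in team by rewrite -index_mem team_index.
by rewrite -(nth_index 0%N kt) Ei nth_index ?eqxx in nk.
Qed.

(** An inequality, since [y] may omit a nonnegative bonus or activate a negative one. *)
Lemma assignment_for_objective :
  du_objective D x y <= total_gain (assigned D assignment_for).
Proof.
rewrite total_gain_assigned; last exact: assignment_for_le.
have zt (i : 'I_n) : (0 < assignment_for t i)%N = x i.
  by rewrite /assignment_for ltnn /xx extend_ord; case: (x i).
apply: lerD.
  apply: ler_sum => i _; rewrite zt str_ord.
  by case: (x i); rewrite ?mul1r ?mul0r.
apply: ler_sum => i _; apply: ler_sum => j _; apply: ler_sum => k _.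
rewrite zt bon_ord; case: hxy => _ /(_ i j k) yx /(_ i j k).
case: (y i j k) yx => /= [xi|_ _]; last first.
  by rewrite mulr0; case: ifP => // /and3P[].
(* For an active indicator the term in [M] vanishes, so the constraint says that the threshold is
   reached. *)
rewrite subrr mulr0 subr_ge0 mulr1.
have -> : \sum_i' (member D i' j)%:R * (x i')%:R
    = \sum_(i' < n) (member D i' j)%:R * (xx i')%:R :> R.
  by apply: eq_bigr => i' _; rewrite /xx extend_ord.
rewrite count_members ler_nat -size_filter -/(members j) => hk.
have -> : (0 < assignment_for j k)%N.
  by rewrite /assignment_for ltn_ord hk ltn_ord.
case: (x i) xi => // _ /=.
by case: (lerP 0 (bonus D i j k)) => // /ltW.
Qed.

End Complete.

Lemma max_clique_optimal (C : {set 'I_(order D)}) :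
  max_clique (graph D) C ->
  du_optimal M D (team_of (assignment_of C)) (active_of (assignment_of C)).
Proof.
move=> mC; have z_le := assignment_of_le C.
have EC := max_clique_assigned mC.
have hz : consistent D (assignment_of C).
  by apply/(clique_assigned z_le); rewrite -EC; case: mC.
split=> [|x y hxy]; first exact: consistent_feasible.
rewrite consistent_objective // -EC.
apply: le_trans (assignment_for_objective hxy) _.
have z_le' := assignment_for_le x.
have := proj2 mC _ (proj2 (clique_assigned z_le') (assignment_for_consistent hxy)).
(* Both cliques have [nclass] vertices, so the prizes cancel and gains are compared. *)
rewrite -(@ler_pMn2r _ 2) // !clique_weightE card_assigned // (max_clique_card mC).
by rewrite lerD2l ler_pMn2r.
Qed.

End Teams.

(** * The programs *)

Definition NEq (a b : nexp) : bexp := BAnd (NLe a b) (NLe b a).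
Definition NLt (a b : nexp) : bexp := BNot (NLe b a).
Definition BOr (a b : bexp) : bexp := BNot (BAnd (BNot a) (BNot b)).
Definition scalar (v : nat) : nexp := NGet v [::].

Section Bexp.
Variables (R : realType) (m : memory R).

Lemma beval_eq a b : beval m (NEq a b) = (neval m a == neval m b).
Proof. by rewrite /= eqn_leq. Qed.

Lemma beval_lt a b : beval m (NLt a b) = (neval m a < neval m b)%N.
Proof. by rewrite /= -ltnNge. Qed.

Lemma beval_or a b : beval m (BOr a b) = beval m a || beval m b.
Proof. by rewrite /= negb_and !negbK. Qed.

Lemma beval_and a b : beval m (BAnd a b) = beval m a && beval m b.
Proof. by []. Qed.

Lemma beval_not a : beval m (BNot a) = ~~ beval m a.
Proof. by []. Qed.

Lemma beval_le a b : beval m (NLe a b) = (neval m a <= neval m b)%N.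
Proof. by []. Qed.

Lemma beval_rle a b : beval m (RLe a b) = (reval m a <= reval m b).
Proof. by []. Qed.

Lemma neval_const k : neval m (NConst k) = k.
Proof. by []. Qed.

Lemma neval_add a b : neval m (NAdd a b) = (neval m a + neval m b)%N.
Proof. by []. Qed.

Definition bevalE :=
  (neval_const, neval_add, beval_eq, beval_lt, beval_or, beval_and, beval_not,
   beval_le, beval_rle).

End Bexp.

Lemma natcell_final_nset (R : realType) (m : memory R) v ix e ad :
  natcell (final (NSet v ix e) m) v ad
  = if ad == map (neval m) ix then neval m e else natcell m v ad.
Proof. by rewrite /final /= /upd eqxx. Qed.

(** * The program texts *)

Definition n_count := 10%N.
Definition n_gof := 11%N.
Definition n_kof := 12%N.
Definition n_vof := 13%N.
Definition n_i := 14%N.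
Definition n_j := 15%N.
Definition n_k := 16%N.
Definition n_token := 17%N.
Definition r_gain := 3%N.
Definition r_total := 4%N.

(** The machine has no division, so the coordinates of vertices are tabulated by loops that visit
    the triples in the order of [code]. *)
Definition record_vertex : cmd :=
  Seq (NSet n_gof [:: scalar n_count] (scalar n_i))
 (Seq (NSet n_kof [:: scalar n_count] (scalar n_j))
 (Seq (NSet n_vof [:: scalar n_count] (scalar n_k))
      (NSet n_count [::] (NAdd (scalar n_count) (NConst 1))))).

Definition record_values : cmd :=
  For n_k (NAdd (scalar n_heroes) (NConst 1)) record_vertex.

Definition record_row (q : nat) : cmd :=
  For n_j (NAdd (scalar n_heroes) (NConst q.+2)) record_values.

Definition enumerate (q : nat) : cmd :=
  Seq (For n_i (NAdd (scalar n_alliances) (NConst 1)) (record_row q))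
      (NSet n_order [::] (scalar n_count)).

Definition get_g (u : nat) : nexp := NGet n_gof [:: scalar u].
Definition get_k (u : nat) : nexp := NGet n_kof [:: scalar u].
Definition get_v (u : nat) : nexp := NGet n_vof [:: scalar u].

Definition test_ok (q u : nat) : bexp :=
  BOr (NLe (get_v u) (NConst 0))
 (BOr (BAnd (NLt (get_g u) (scalar n_alliances))
      (BAnd (NLt (get_k u) (NConst q))
            (NLt (NConst 0) (NGet n_member [:: NSub (get_v u) (NConst 1); get_g u]))))
      (BAnd (NLe (scalar n_alliances) (get_g u))
      (BAnd (NLt (get_k u) (scalar n_heroes))
            (NLe (get_v u) (scalar n_team_max))))).

Definition test_excl (u w : nat) : bexp :=
  BNot (BAnd (NEq (get_g u) (get_g w))
    (BOr (NEq (get_k u) (get_k w))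
         (BAnd (NEq (get_v u) (get_v w)) (NLt (NConst 0) (get_v u))))).

Definition test_req (u w : nat) : bexp :=
  BNot (BAnd (NLt (get_g u) (scalar n_alliances))
       (BAnd (NLt (NConst 0) (get_v u))
       (BAnd (NLe (get_v w) (NConst 0))
       (BOr (BAnd (NEq (get_g u) (get_g w)) (NLt (get_k w) (get_k u)))
            (BAnd (NLe (scalar n_alliances) (get_g w))
                  (NEq (get_v u) (NAdd (get_k w) (NConst 1)))))))).

Definition test_edge (q u w : nat) : bexp :=
  BAnd (test_ok q u) (BAnd (test_ok q w) (BAnd (test_excl u w)
    (BAnd (test_req u w) (test_req w u)))).

Definition pairs : seq (nat * nexp) := [:: (n_i, scalar n_order); (n_j, scalar n_order)].

Definition write_edges (q : nat) : cmd :=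
  nest pairs
    (If (test_edge q n_i n_j) (NSet n_edge [:: scalar n_i; scalar n_j] (NConst 1))
                              (NSet n_edge [:: scalar n_i; scalar n_j] (NConst 0))).

Definition set_gain : rexp -> cmd := RSet r_gain [:: scalar n_i; scalar n_j].

Definition write_gains : cmd :=
  let b := RGet r_bonus [:: get_k n_i; get_g n_j; get_k n_j] in
  nest pairs
    (If (BAnd (NLe (scalar n_alliances) (get_g n_i)) (NLt (NConst 0) (get_v n_i)))
       (If (NLt (get_g n_j) (scalar n_alliances))
          (If (BAnd (NLt (NConst 0) (get_v n_j)) (RLe RZero b))
             (set_gain b) (set_gain RZero))
          (If (NEq (get_k n_j) (scalar n_heroes))
             (set_gain (RGet r_strength [:: get_k n_i])) (set_gain RZero)))
       (set_gain RZero)).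

Definition write_total : cmd :=
  let g := RGet r_gain [:: scalar n_i; scalar n_j] in
  let s := RGet r_total [::] in
  nest pairs (If (RLe RZero g) (RSet r_total [::] (RAdd s g))
                               (RSet r_total [::] (RSub s g))).

Definition write_weights : cmd :=
  let s := RGet r_total [::] in
  nest pairs
    (RSet r_weight [:: scalar n_i; scalar n_j]
       (RAdd (RAdd (RGet r_gain [:: scalar n_i; scalar n_j])
                   (RGet r_gain [:: scalar n_j; scalar n_i]))
             (RAdd ROne (RAdd (RAdd s s) (RAdd s s))))).

Definition write_graph (q : nat) : cmd :=
  Seq (write_edges q) (Seq write_gains (Seq write_total write_weights)).

Definition build (q : nat) : cmd := Seq (enumerate q) (write_graph q).

(** Only nonzero values are recorded; all other cells of [n_team] and [n_token] rely on being zero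
    initially. *)
Definition read_clique : cmd :=
  For n_i (scalar n_order)
    (If (BAnd (NLt (NConst 0) (NGet n_clique [:: scalar n_i]))
              (NLt (NConst 0) (get_v n_i)))
       (If (NLe (scalar n_alliances) (get_g n_i))
          (NSet n_team [:: get_k n_i] (NConst 1))
          (NSet n_token [:: get_g n_i; get_k n_i] (NConst 1)))
       Skip).

Definition write_active (q : nat) : cmd :=
  let ix := [:: scalar n_i; scalar n_j; scalar n_k] in
  nest [:: (n_i, scalar n_heroes); (n_j, scalar n_alliances); (n_k, NConst q)]
    (If (BAnd (NLt (NConst 0) (NGet n_team [:: scalar n_i]))
        (BAnd (NLt (NConst 0) (NGet n_token [:: scalar n_j; scalar n_k]))
              (RLe RZero (RGet r_bonus ix))))
       (NSet n_active ix (NConst 1)) (NSet n_active ix (NConst 0))).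

Definition recover (q : nat) : cmd :=
  Seq (enumerate q) (Seq read_clique (write_active q)).

(** * Correctness of the programs *)

Section Correctness.
Variables (R : realType) (q : nat) (D : du R q).
Implicit Type m : memory R.
Local Notation n := (heroes D).
Local Notation t := (alliances D).

Definition inputs m : Prop :=
  (forall v, v \in [:: n_heroes; n_team_max; n_alliances; n_member] ->
     natcell m v = natcell (du_mem D) v)
  /\ (forall v, v \in [:: r_strength; r_bonus] -> realcell m v = realcell (du_mem D) v).

Definition enumerated (p : nat) m : Prop :=
  forall u, (u < p)%N ->
    [/\ natcell m n_gof [:: u] = gof D u, natcell m n_kof [:: u] = kof D u
      & natcell m n_vof [:: u] = vof D u].

Definition prepared m : Prop :=
  [/\ inputs m, enumerated (order D) m & natcell m n_order [::] = order D].

Lemma inputs_agree c m m' :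
  all (fun v => v \notin nwrites c) [:: n_heroes; n_team_max; n_alliances; n_member] ->
  all (fun v => v \notin rwrites c) [:: r_strength; r_bonus] ->
  agree c m m' -> inputs m -> inputs m'.
Proof.
move=> /allP hn /allP hr [an ar] [im rm]; split=> v hv; first by rewrite an ?im ?hn.
by rewrite ar ?rm ?hr.
Qed.

Lemma inputs_nset m v ix a :
  v \notin [:: n_heroes; n_team_max; n_alliances; n_member] ->
  inputs m -> inputs (nset v ix a m).
Proof.
move=> hv; apply: (inputs_agree (c := NSet v [::] (NConst 0))) => //.
  by apply/allP => w hw; rewrite inE; apply: contraNneq hv => <-.
by apply: agree_nset; apply: mem_head.
Qed.

Lemma prepared_agree c m m' :
  all (fun v => v \notin nwrites c) [:: n_heroes; n_team_max; n_alliances; n_member] ->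
  all (fun v => v \notin nwrites c) [:: n_gof; n_kof; n_vof; n_order] ->
  all (fun v => v \notin rwrites c) [:: r_strength; r_bonus] ->
  agree c m m' -> prepared m -> prepared m'.
Proof.
move=> hi /= /and5P[hg hk hv ho _] hr ag [im em om]; split.
- exact: inputs_agree ag im.
- by move=> u /em[eg ek ev]; split; rewrite (proj1 ag).
by rewrite (proj1 ag).
Qed.

Lemma prepared_nset m v ix a :
  v \notin [:: n_heroes; n_team_max; n_alliances; n_member] ->
  v \notin [:: n_gof; n_kof; n_vof; n_order] ->
  prepared m -> prepared (nset v ix a m).
Proof.
move=> hv hv'; apply: (prepared_agree (c := NSet v [::] (NConst 0))) => //.
- by apply/allP => w hw; rewrite inE; apply: contraNneq hv => <-.
- by apply/allP => w hw; rewrite inE; apply: contraNneq hv' => <-.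
by apply: agree_nset; apply: mem_head.
Qed.

Section Inputs.
Variable m : memory R.
Hypothesis hm : inputs m.

Lemma inputs_heroes : natcell m n_heroes [::] = n.
Proof. by rewrite (proj1 hm). Qed.
Lemma inputs_team_max : natcell m n_team_max [::] = team_max D.
Proof. by rewrite (proj1 hm). Qed.
Lemma inputs_alliances : natcell m n_alliances [::] = t.
Proof. by rewrite (proj1 hm). Qed.
Lemma inputs_member i j : (0 < natcell m n_member [:: i; j])%N = mem D i j.
Proof. by rewrite (proj1 hm). Qed.
Lemma inputs_strength i : realcell m r_strength [:: i] = str D i.
Proof. by rewrite (proj2 hm). Qed.
Lemma inputs_bonus i j k : realcell m r_bonus [:: i; j; k] = bon D i j k.
Proof. by rewrite (proj2 hm). Qed.

End Inputs.

Let counted p m := natcell m n_count [::] = p /\ enumerated p m.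

Lemma record_vertexP m g k v :
  (k < width D)%N -> (v <= n)%N ->
  natcell m n_i [::] = g -> natcell m n_j [::] = k -> natcell m n_k [::] = v ->
  counted (code D g k v) m -> counted (code D g k v).+1 (final record_vertex m).
Proof.
move=> kw vn hg hk hv [hc he]; rewrite /record_vertex !final_seq /counted /enumerated.
rewrite /final /= /upd /= hc; split; first by rewrite addn1.
move=> u; rewrite ltnS leq_eqVlt => /orP[/eqP ->|lt].
  by rewrite !eqxx hg hk hv gof_code // kof_code // vof_code.
by have [-> -> ->] := he u lt; rewrite !eqseq_cons !(ltn_eqF lt).
Qed.

Lemma record_valuesP m g k :
  inputs m -> (k < width D)%N -> natcell m n_i [::] = g -> natcell m n_j [::] = k ->
  counted (code D g k 0) m -> counted (code D g k.+1 0) (final record_values m).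
Proof.
move=> im kw hg hk cm.
(* As in positional notation, the end of one run of values is the start of the next. *)
have -> : code D g k.+1 0 = code D g k n.+1.
  by rewrite /code addn0 addnS mulSn addnC.
have -> : n.+1 = neval m (NAdd (scalar n_heroes) (NConst 1)).
  by rewrite /= inputs_heroes // addn1.
apply: (for_agree_ind (I := fun v => counted (code D g k v))) => // v m1.
rewrite /= inputs_heroes // addn1 ltnS => vn ag1 c1.
by rewrite /code addnS; apply: record_vertexP => //; rewrite /= /upd /= (proj1 ag1).
Qed.

Lemma record_rowP m g :
  inputs m -> natcell m n_i [::] = g ->
  counted (code D g 0 0) m -> counted (code D g.+1 0 0) (final (record_row q) m).
Proof.
move=> im hg cm.
have -> : code D g.+1 0 0 = code D g (width D) 0.
  by rewrite /code mulSn addnC [(width D + _)%N]addnC !addn0.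
have wE : width D = neval m (NAdd (scalar n_heroes) (NConst q.+2)).
  by rewrite /= inputs_heroes // /width !addnS.
rewrite {1}wE.
apply: (for_agree_ind (I := fun k => counted (code D g k 0))) => // k m1.
rewrite -wE => kw ag1 c1.
apply: record_valuesP => //; last by rewrite /= /upd /= (proj1 ag1).
have : inputs m1 by apply: inputs_agree ag1 im.
exact: inputs_nset.
Qed.

Lemma enumerate_prepared m :
  inputs m -> natcell m n_count [::] = 0%N -> prepared (final (enumerate q) m).
Proof.
move=> im c0; rewrite /enumerate final_seq; set c := For _ _ _.
have ic : inputs (final c m) by apply: inputs_agree (agree_final c m) im.
suff [Hc He] : counted (order D) (final c m).
  by split=> //; apply: inputs_agree (agree_final _ _) ic.
have -> : order D = code D t.+1 0 0 by rewrite /code /order /nclass !addn0.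
have -> : t.+1 = neval m (NAdd (scalar n_alliances) (NConst 1)).
  by rewrite /= inputs_alliances // addn1.
apply: (for_agree_ind (I := fun g => counted (code D g 0 0))) => [//|g m1 _ ag1 c1].
apply: record_rowP => //.
have : inputs m1 by apply: inputs_agree ag1 im.
exact: inputs_nset.
Qed.

Section Prepared.
Variables (m : memory R) (u i : nat).
Hypotheses (hm : prepared m) (ui : natcell m u [::] = i) (iN : (i < order D)%N).

(** A product of equations serves [rewrite] as one multirule. *)
Lemma prepared_scalars :
  (neval m (scalar n_alliances) = t) * (neval m (scalar n_heroes) = n)
  * (neval m (scalar n_team_max) = team_max D).
Proof.
case: hm => im _ _.
by rewrite /= inputs_alliances // inputs_heroes // inputs_team_max.
Qed.

Lemma prepared_vertex :
  (neval m (get_g u) = gof D i) * (neval m (get_k u) = kof D i)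
  * (neval m (get_v u) = vof D i).
Proof. by case: hm => _ /(_ _ iN) [hg hk hv] _; rewrite /= ui hg hk hv. Qed.

Lemma test_okP : beval m (test_ok q u) = ok D (gof D i) (kof D i) (vof D i).
Proof.
rewrite !bevalE !prepared_scalars !prepared_vertex /ok.
rewrite -[neval m (NGet n_member _)]/(natcell m n_member
  [:: (neval m (get_v u) - 1)%N; neval m (get_g u)]).
by case: (hm) => im _ _; rewrite inputs_member // !prepared_vertex subn1.
Qed.

End Prepared.

Lemma test_edgeP m u w i j :
  prepared m -> natcell m u [::] = i -> natcell m w [::] = j ->
  (i < order D)%N -> (j < order D)%N -> beval m (test_edge q u w) = edge_at D i j.
Proof.
move=> hm ui wj iN jN.
have [pi pj] := (prepared_vertex hm ui iN, prepared_vertex hm wj jN).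
rewrite /test_edge; do 4 rewrite beval_and.
rewrite (test_okP hm ui) // (test_okP hm wj) // /test_excl /test_req.
by rewrite !bevalE !(prepared_scalars hm) !pi !pj !addn1.
Qed.

Lemma inbox2 a b ix : inbox [:: a; b] ix ->
  exists i j, [/\ ix = [:: i; j], (i < a)%N & (j < b)%N].
Proof.
case: ix => [|i [|j [|? ?]]] //; rewrite /inbox /= andbT => /andP[ia jb].
by exists i, j.
Qed.

(** The frame hypotheses preserve [prepared], so a loop body need only be analysed in prepared
    memories. *)
Lemma nest_pairs_fill (X : Type) (get : memory R -> seq nat -> X) f c m :
  prepared m ->
  all (fun v => v \notin nwrites c) [:: n_heroes; n_team_max; n_alliances; n_member] ->
  all (fun v => v \notin nwrites c) [:: n_gof; n_kof; n_vof; n_order] ->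
  all (fun v => v \notin nwrites c) [:: n_i; n_j] ->
  all (fun v => v \notin rwrites c) [:: r_strength; r_bonus] ->
  (forall m' v i ix, v \in [:: n_i; n_j] -> get (nset v [::] i m') ix = get m' ix) ->
  (forall m' i j, prepared m' -> agree (nest pairs c) m m' ->
     natcell m' n_i [::] = i -> natcell m' n_j [::] = j ->
     (i < order D)%N -> (j < order D)%N ->
     forall ad, get (final c m') ad = if ad == [:: i; j] then f i j else get m' ad) ->
  forall i j, (i < order D)%N -> (j < order D)%N ->
    get (final (nest pairs c) m) [:: i; j] = f i j.
Proof.
move=> pm hi ha hl hr getv hc i j iN jN.
have pr m' : agree (nest pairs c) m m' -> prepared m'.
  move=> ag; apply: prepared_agree ag pm.
  - by rewrite nwrites_nest /=; move: hi.
  - by rewrite nwrites_nest /=; move: ha.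
  by rewrite rwrites_nest.
have := @nest_fill _ _ get (fun ix => f (nth 0 ix 0) (nth 0 ix 1))%N pairs
  [:: order D; order D] c m getv isT hl.
apply=> [m' /pr [_ _ /= ->] //|m' ix ag /inbox2[i' [j' [-> i'N j'N]]] [ei ej] ad|].
  exact: hc (pr _ ag) ag ei ej i'N j'N ad.
by rewrite /inbox /= iN jN.
Qed.

Lemma write_edgesP m i j : prepared m -> (i < order D)%N -> (j < order D)%N ->
  natcell (final (write_edges q) m) n_edge [:: i; j] = edge_at D i j.
Proof.
move=> pm.
apply: (nest_pairs_fill (get := fun m => natcell m n_edge)
  (f := fun i j => nat_of_bool (edge_at D i j)) pm) => //.
  by move=> m' v k ix; rewrite !inE => /orP[]/eqP->.
move=> m' i' j' pm' _ ei ej i'N j'N ad; rewrite final_if (test_edgeP pm' ei ej) //.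
by case: (edge_at _ _ _); rewrite /final /= /upd /= ei ej.
Qed.

Lemma write_gainsP m i j : prepared m -> (i < order D)%N -> (j < order D)%N ->
  realcell (final write_gains m) r_gain [:: i; j] = gain_at D i j.
Proof.
move=> pm.
apply: (nest_pairs_fill (get := fun m => realcell m r_gain) (f := gain_at D) pm) => //.
move=> m' i' j' pm' _ ei ej i'N j'N ad.
have [pi pj] := (prepared_vertex pm' ei i'N, prepared_vertex pm' ej j'N).
have bE : reval m' (RGet r_bonus [:: get_k n_i; get_g n_j; get_k n_j])
    = bon D (kof D i') (gof D j') (kof D j').
  case: (pm') => im _ _; rewrite -(inputs_bonus im) -!pi -!pj.
  by [].
have sE : reval m' (RGet r_strength [:: get_k n_i]) = str D (kof D i').
  by case: (pm') => im _ _; rewrite -(inputs_strength im) -!pi.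
have setE e : realcell (final (set_gain e) m') r_gain ad
    = if ad == [:: i'; j'] then reval m' e else realcell m' r_gain ad.
  by rewrite /final /= /upd /= ei ej.
rewrite !final_if !bevalE !(prepared_scalars pm') !pi !pj bE /gain_at /gain.
by case: ifP => _; [case: ifP => _; case: ifP => _|]; rewrite setE ?bE ?sE.
Qed.

(** This loop accumulates into one cell instead of filling an array, so it takes two nested
    invariants on partial sums. *)
Lemma write_totalP m : prepared m -> realcell m r_total [::] = 0 ->
  (forall i j, (i < order D)%N -> (j < order D)%N ->
     realcell m r_gain [:: i; j] = gain_at D i j) ->
  realcell (final write_total m) r_total [::] = gain_total D.
Proof.
move=> pm m0 hg; rewrite /write_total /nest /pairs /gain_total.
rewrite -(big_mkord xpredT (fun i => \sum_(w < order D) `|gain_at D i w|)).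
have oE m' : prepared m' -> neval m' (scalar n_order) = order D by case.
rewrite -{1}(oE m pm).
apply: (for_agree_ind (I := fun i m' => realcell m' r_total [::] =
  \sum_(0 <= u < i) \sum_(w < order D) `|gain_at D u w|)).
  by rewrite big_geq.
move=> i m1; rewrite oE // => iN ag1 I1.
rewrite big_nat_recr //= -I1 -(big_mkord xpredT (fun w => `|gain_at D i w|)).
have p1 : prepared m1 by apply: prepared_agree ag1 pm.
have p1' : prepared (nset n_i [::] i m1).
  exact: prepared_nset.
rewrite -{1}(oE _ p1').
apply: (for_agree_ind (I := fun j m' => realcell m' r_total [::] =
  realcell m1 r_total [::] + \sum_(0 <= w < j) `|gain_at D i w|)).
  by rewrite big_geq //= addr0.
move=> j m2; rewrite oE // => jN ag2 I2.
rewrite big_nat_recr //= addrA -I2 final_if beval_rle.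
have gE : reval (nset n_j [::] j m2) (RGet r_gain [:: scalar n_i; scalar n_j])
    = gain_at D i j.
  rewrite /= /upd /= (proj1 ag2) //= /upd /=.
  by rewrite (proj2 ag2) //= (proj2 ag1) // hg.
rewrite [reval _ RZero]/= gE.
case: (lerP 0 (gain_at D i j)) => h.
  by rewrite ger0_norm // -gE.
by rewrite ltr0_norm // -gE.
Qed.

Lemma write_weightsP m i j : prepared m -> realcell m r_total [::] = gain_total D ->
  (forall i j, (i < order D)%N -> (j < order D)%N ->
     realcell m r_gain [:: i; j] = gain_at D i j) ->
  (i < order D)%N -> (j < order D)%N ->
  realcell (final write_weights m) r_weight [:: i; j] = weight_at D i j.
Proof.
move=> pm tm gm.
apply: (nest_pairs_fill (get := fun m => realcell m r_weight)
  (f := weight_at D) pm) => //.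
move=> m' i' j' pm' ag ei ej i'N j'N ad.
rewrite /final /= /upd /= ei ej !(proj2 ag r_gain) ?(proj2 ag r_total) // !gm // tm.
by rewrite /weight_at /edge_prize !mulrS mulr0n addr0 !addrA.
Qed.

Lemma build_holds_graph : holds_graph (final (build q) (du_mem D)) (graph D).
Proof.
rewrite /build /write_graph; do 4 rewrite final_seq.
have p1 : prepared (final (enumerate q) (du_mem D)) by apply: enumerate_prepared.
have t1 : realcell (final (enumerate q) (du_mem D)) r_total [::] = 0.
  by rewrite (proj2 (agree_final _ _)).
set m1 := final _ _ in p1 t1 *.
(* Each intermediate memory is made opaque; only its specification and frame matter from here on. *)
clearbody m1.
have ag2 := agree_final (write_edges q) m1; have e2 := write_edgesP p1.
set m2 := final _ m1 in ag2 e2 *.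
clearbody m2.
have p2 : prepared m2 by apply: prepared_agree ag2 p1.
have ag3 := agree_final write_gains m2; have g3 := write_gainsP p2.
set m3 := final _ m2 in ag3 g3 *.
clearbody m3.
have p3 : prepared m3 by apply: prepared_agree ag3 p2.
have t3 : realcell m3 r_total [::] = 0 by rewrite (proj2 ag3) // (proj2 ag2).
have ag4 := agree_final write_total m3.
have t4 := write_totalP p3 t3 (fun i j iN jN => g3 i j iN jN).
set m4 := final _ m3 in ag4 t4 *.
clearbody m4.
have p4 : prepared m4 by apply: prepared_agree ag4 p3.
have ag5 := agree_final write_weights m4.
have w5 := write_weightsP p4 t4.
set m5 := final _ m4 in ag5 w5 *.
clearbody m5.
have p5 : prepared m5 by apply: prepared_agree ag5 p4.
split=> [|u w|u w _]; first by case: p5.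
  rewrite (proj1 ag5) // (proj1 ag4) // (proj1 ag3) //.
  exact: e2 (ltn_ord u) (ltn_ord w).
by apply: w5 (ltn_ord u) (ltn_ord w) => i j iN jN; rewrite (proj2 ag4) // g3.
Qed.

(** * Reading a solution off a clique *)

Section Recover.
Variable C : {set 'I_(order D)}.
Let z := assignment_of C.

(** The loop invariant of [read_clique]: what its marks record after the first [i] vertices. *)
Definition seen (i g k : nat) : bool :=
  has (fun u => [&& extend false (fun u => u \in C) u, (0 < vof D u)%N, gof D u == g
                  & kof D u == k]) (iota 0 i).

Lemma seen_all g k : seen (order D) g k = (0 < z g k)%N.
Proof.
apply/hasP/idP => [[u]|/assignment_of_gt0[u uC [gu ku vu]]]; last first.
  by exists (val u); rewrite ?mem_iota ?ltn_ord // extend_ord uC vu gu ku !eqxx.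
rewrite mem_iota /= add0n => uN; rewrite -[u]/(val (Ordinal uN)) extend_ord.
move=> /and4P[uC vu /eqP gu /eqP ku]; apply/assignment_of_gt0.
by exists (Ordinal uN).
Qed.

Lemma seenS i g k : seen i.+1 g k = seen i g k
  || [&& extend false (fun u => u \in C) i, (0 < vof D i)%N, gof D i == g
                  & kof D i == k].
Proof. by rewrite /seen -[in iota _ _]addn1 iotaD has_cat /= orbF. Qed.

Lemma read_cliqueP m : prepared m ->
  (forall u : 'I_(order D), natcell m n_clique [:: val u] = (u \in C)) ->
  (forall ix, natcell m n_team ix = 0%N) -> (forall ix, natcell m n_token ix = 0%N) ->
  let m' := final read_clique m in
  (forall k, natcell m' n_team [:: k] = (0 < z t k)%N)
  /\ (forall g k, (g < t)%N -> natcell m' n_token [:: g; k] = (0 < z g k)%N).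
Proof.
move=> pm mC m0 m0' /=.
pose I i m' := (forall k, natcell m' n_team [:: k] = seen i t k)
  /\ (forall g k, (g < t)%N -> natcell m' n_token [:: g; k] = seen i g k).
have oE : order D = neval m (scalar n_order) by case: pm.
suff: I (order D) (final read_clique m).
  by case=> h1 h2; split=> [k|g k gt]; rewrite ?h1 ?h2 // seen_all.
rewrite {1}oE; apply: for_agree_ind => [|i m1].
  by split=> *; rewrite ?m0 ?m0'.
rewrite -oE => iN ag1 [It Ig].
have p1 : prepared (nset n_i [::] i m1).
  by apply: prepared_nset => //; apply: prepared_agree ag1 pm.
have ei : natcell (nset n_i [::] i m1) n_i [::] = i by [].
have pi := prepared_vertex p1 ei iN.
have cE : neval (nset n_i [::] i m1) (NGet n_clique [:: scalar n_i])
    = extend false (fun u => u \in C) i.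
  rewrite -[i in RHS]/(val (Ordinal iN)) extend_ord -mC /= -(proj1 ag1) //.
have gi := gof_le iN.
rewrite !final_if !bevalE cE !(prepared_scalars p1) !pi lt0b.
have E : I i (nset n_i [::] i m1) by [].
case: ifP => [/andP[iC vi]|h]; last first.
  split=> [k|g k gt]; rewrite ?(proj1 E) ?(proj2 E) // seenS;
    by rewrite andbA h orbF.
case: (leqP t (gof D i)) => tg.
  have gt : gof D i = t by apply/eqP; rewrite eqn_leq gi.
  split=> [k|g k g't].
    rewrite natcell_final_nset map_cons pi (proj1 E) seenS iC vi gt eqxx /=.
    rewrite eqseq_cons andbT eq_sym.
    by case: (_ == _); rewrite ?orbT ?orbF.
  by rewrite seenS gt (gtn_eqF g't) !andbF orbF -Ig.
split=> [k|g k g't].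
  by rewrite seenS (ltn_eqF tg) !andbF orbF -It.
rewrite natcell_final_nset !map_cons !pi (proj2 E) // seenS iC vi /=.
rewrite !eqseq_cons andbT [g == _]eq_sym [k == _]eq_sym.
by case: (_ && _); rewrite ?orbT ?orbF.
Qed.

Lemma recover_holds_solution :
  holds_solution (final (recover q) (du_clique_mem D C))
    (@team_of R q D z) (@active_of R q D z).
Proof.
rewrite /recover; do 2 rewrite final_seq; set m0 := du_clique_mem D C.
have p1 : prepared (final (enumerate q) m0).
  apply: enumerate_prepared => //; split=> // v.
  by rewrite !inE => /or4P[]/eqP->.
have ag1 := agree_final (enumerate q) m0.
set m1 := final _ m0 in p1 ag1 *.
clearbody m1.
have [] := @read_cliqueP m1 p1.
- by move=> u; rewrite (proj1 ag1) //= extend_ord.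
- by move=> ix; rewrite (proj1 ag1).
- by move=> ix; rewrite (proj1 ag1).
have ag2 := agree_final read_clique m1.
set m2 := final read_clique m1 in ag2 * => ht hk.
clearbody m2.
have p2 : prepared m2 by apply: prepared_agree ag2 p1.
have ag3 := agree_final (write_active q) m2.
split=> [i|i j k]; first by rewrite (proj1 ag3) // ht.
pose f ix := nat_of_bool [&& (0 < z t (nth 0%N ix 0))%N,
  (0 < z (nth 0%N ix 1) (nth 0%N ix 2))%N
  & 0 <= bon D (nth 0%N ix 0) (nth 0%N ix 1) (nth 0%N ix 2)].
apply: (@nest_fill _ _ (fun m => natcell m n_active) f _ [:: n; t; q]) => //.
- by move=> m' v l ix; rewrite !inE => /or3P[]/eqP->.
- move=> m' ag; have [im _ _] : prepared m' by apply: prepared_agree ag p2.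
  by rewrite /= inputs_heroes // inputs_alliances.
- move=> m' [|a [|b [|c [|? ?]]]] ag //; rewrite /inbox /= => /and4P[an bt cq _].
  move=> [ea eb ec] ad.
  have [im _ _] : prepared m' by apply: prepared_agree ag p2.
  rewrite final_if !bevalE.
  have -> : neval m' (NGet n_team [:: scalar n_i]) = (0 < z t a)%N :> nat.
    by rewrite /= ea (proj1 ag) // ht.
  have -> : neval m' (NGet n_token [:: scalar n_j; scalar n_k]) = (0 < z b c)%N :> nat.
    by rewrite /= eb ec (proj1 ag) // hk.
  have -> : reval m' (RGet r_bonus [:: scalar n_i; scalar n_j; scalar n_k]) = bon D a b c.
    by rewrite -(inputs_bonus im) -ea -eb -ec.
  rewrite !lt0b /f /=.
  by case: ifP => _; rewrite /final /= /upd /= ea eb ec.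
by rewrite /inbox /= !ltn_ord.
Qed.
End Recover.

(** * Polynomial bounds in the size of the instance *)

Definition order_poly : {poly nat} :=
  ('X + 1%:P) * ('X + q.+2%:P) * ('X + 1%:P).

(** A single bound for both programs and for the number of vertices. What follows the enumeration is
    clocked by the order of the graph, hence the compositions. *)
Definition time_poly : {poly nat} :=
  tpoly (enumerate q) + (tpoly (write_graph q) \Po order_poly)
  + (tpoly (Seq read_clique (write_active q)) \Po order_poly) + order_poly.

Lemma heroes_le : (n <= du_size D)%N.
Proof. by rewrite /du_size -!addnA leq_addr. Qed.

Lemma alliances_le : (t <= du_size D)%N.
Proof. by rewrite /du_size -!addnA addnCA leq_addr. Qed.

Lemma order_le : (order D <= order_poly.[du_size D])%N.
Proof.
have -> : order_poly.[du_size D]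
    = ((du_size D + 1) * (du_size D + q.+2) * (du_size D + 1))%N.
  by rewrite /order_poly !hornerM !hornerD hornerX !hornerC.
have := heroes_le; have := alliances_le.
move: (du_size D) => s ts ns; rewrite /order /nclass /width.
by do 2?apply: leq_mul; lia.
Qed.

(** The enumeration writes [n_order], which is therefore protected only in [c]. Heroes and alliances
    are also at most [order D] in number, so this one value bounds all clocks of [c]. *)
Lemma time_from m c :
  inputs m -> natcell m n_count [::] = 0%N ->
  clocked [:: n_heroes; n_alliances] (enumerate q) ->
  clocked [:: n_heroes; n_alliances; n_order] c ->
  (time (Seq (enumerate q) c) m
   <= (tpoly (enumerate q)).[du_size D] + (tpoly c).[order D])%N.
Proof.
move=> im m0 ce cc; rewrite time_seq leq_add //.
  apply: time_bound ce => v; rewrite !inE => /orP[]/eqP->.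
    by rewrite inputs_heroes // heroes_le.
  by rewrite inputs_alliances // alliances_le.
have [im' _ om'] := enumerate_prepared im m0.
apply: time_bound cc => v; rewrite !inE => /or3P[]/eqP->.
- by rewrite inputs_heroes // /order; apply: leq_trans (leqnSn _) (leq_pmull _ _).
- rewrite inputs_alliances // /order /nclass; apply: leq_trans (leqnSn _) _.
  by rewrite -mulnA leq_pmulr.
by rewrite om'.
Qed.

Lemma time_polyE : time_poly.[du_size D]
  = ((tpoly (enumerate q)).[du_size D]
     + (tpoly (write_graph q)).[order_poly.[du_size D]]
     + (tpoly (Seq read_clique (write_active q))).[order_poly.[du_size D]]
     + order_poly.[du_size D])%N.
Proof.
by rewrite /time_poly (hornerD _ order_poly) !(hornerD _ (_ \Po _)) !horner_comp.
Qed.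

Lemma time_build : (time (build q) (du_mem D) <= time_poly.[du_size D])%N.
Proof.
apply: leq_trans (time_from _ _ _ _) _ => //.
rewrite time_polyE -!addnA leq_add2l.
by apply: leq_trans (leq_addr _ _); apply/horner_nat_mono/order_le.
Qed.

Lemma time_recover (C : {set 'I_(order D)}) :
  (time (recover q) (du_clique_mem D C) <= time_poly.[du_size D])%N.
Proof.
apply: leq_trans (time_from _ _ _ _) _ => //.
  by split=> // v; rewrite !inE => /or4P[]/eqP->.
rewrite time_polyE -!addnA leq_add2l.
apply: leq_trans (leq_addl _ _); apply: leq_trans (leq_addr _ _).
exact/horner_nat_mono/order_le.
Qed.

Lemma order_time_poly : (order D <= time_poly.[du_size D])%N.
Proof. by rewrite time_polyE; apply: leq_trans order_le (leq_addl _ _). Qed.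

End Correctness.

Theorem theorem6 (R : realType) (q : nat) (M : R) (hM : q%:R < M) :
  exists (build recover : cmd) (p : {poly nat}),
  forall D : du R q,
    (time build (du_mem D) <= p.[du_size D])%N
    /\ exists G : wgraph R,
      [/\ holds_graph (final build (du_mem D)) G,
          (nvertices G <= p.[du_size D])%N
        & forall C : {set 'I_(nvertices G)}, max_clique G C ->
            (time recover (du_clique_mem D C) <= p.[du_size D])%N
            /\ exists (x : du_team D) (y : du_active D),
                 holds_solution (final recover (du_clique_mem D C)) x y
                 /\ du_optimal M D x y].
Proof.
exists (build q), (recover q), (time_poly q) => D.
split; first exact: time_build.
exists (graph D); split=> [||C mC].
- exact: build_holds_graph.
- exact: order_time_poly.
split; first exact: time_recover.
exists (team_of (assignment_of C)), (active_of (assignment_of C)).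
split; [exact: recover_holds_solution | exact: max_clique_optimal].
Qed.
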